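(* Suppose that $\{z^t\}_{t\ge0}$ is a sequence generated by QRTC (as defined in the context) and that $z^*$ is its limit. Let $\theta\in[0,1)$ be an exponent for which the Kurdyka–Łojasiewicz inequality holds at $z^*$, i.e. there are a neighborhood $Z'$ of $z^*$ and a constant $K_3>0$ with $$|f(z)-f(z^* )|^\theta\le K_3\|\Pi_\Lambda(\nabla f(z))\|_F\qquad\text{for all } z\in Z'\cap\Lambda .$$ Then the following hold. (i) If $\theta\in(0,\frac12]$, there exist $\gamma>0$ and $\xi\in(0,1)$ such that $\|z^t-z^*\|_2\le\gamma\,\xi^t$ for all $t$. (ii) If $\theta\in(\frac12,1)$, there exists $\gamma>0$ such that $\|z^t-z^*\|_2\le\gamma\, t^{-\frac{1-\theta}{2\theta-1}}$ for all $t\ge1$.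
   Context: $\mathbb{H}$ is the real quaternion algebra with units $\mathbf{i},\mathbf{j},\mathbf{k}$; for a quaternion matrix, $A^*$ is the conjugate transpose; $\|\cdot\|_F$ is the Frobenius norm of quaternion matrices/tensors (the Euclidean norm for real vectors); $\Re$ is the entrywise real part. Fix a unit pure quaternion $\mu$ ($\mu^2=-1$). $F_{\mu,n}\in\mathbb{H}^{n\times n}$ has entries $\frac1{\sqrt n}\left(\cos\frac{2\pi(p-1)(q-1)}{n}-\mu\sin\frac{2\pi(p-1)(q-1)}{n}\right)$. The QDFT $\hat{\mathcal{X}}$ of $\mathcal{X}\in\mathbb{H}^{n_1\times n_2\times n_3}$ is the tensor with $\hat{\mathcal{X}}(i,j,:)=\sqrt{n_3}\,F_{\mu,n_3}\mathcal{X}(i,j,:)$ (an invertible map), and $\hat{\mathcal{X}}^{(l)}=\hat{\mathcal{X}}(:,:,l)$. Data: $\mathcal{M}\in\mathbb{H}^{n_1\times n_2\times n_3}$ with $\Re(\mathcal{M})=0$; $\Omega\subseteq\{1,\dots,n_1\}\times\{1,\dots,n_2\}\times\{1,\dots,n_3\}$ with complement $\Omega^c$; $P_\Omega$ (resp. $P_{\Omega^c}$) keeps the entries indexed by $\Omega$ (resp. $\Omega^c$) and sets the others to zero; positive integers $\mathbf{r}=(r_1,\dots,r_{n_3})$; parameters $\lambda,\lambda_1,\lambda_2,\beta>0$. Variables: $\mathcal{C}=\mathcal{C}_{\mathbf i}\mathbf{i}+\mathcal{C}_{\mathbf j}\mathbf{j}+\mathcal{C}_{\mathbf k}\mathbf{k}$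 with real tensors $\mathcal{C}_\alpha\in\mathbb{R}^{n_1\times n_2\times n_3}$; $\hat{\mathcal{A}}=(\hat{\mathcal{A}}^{(l)})_{l=1}^{n_3}$ with $\hat{\mathcal{A}}^{(l)}\in\mathbb{H}^{n_1\times r_l}$; $\hat{\mathcal{B}}=(\hat{\mathcal{B}}^{(l)})_{l=1}^{n_3}$ with $\hat{\mathcal{B}}^{(l)}\in\mathbb{H}^{r_l\times n_2}$; $\|\hat{\mathcal{A}}\|_F^2=\sum_l\|\hat{\mathcal{A}}^{(l)}\|_F^2$, likewise for $\hat{\mathcal{B}}$. $\mathcal{A}*_\mu\mathcal{B}\in\mathbb{H}^{n_1\times n_2\times n_3}$ denotes the tensor whose QDFT has $l$-th frontal slice $\hat{\mathcal{A}}^{(l)}\hat{\mathcal{B}}^{(l)}$. All real components of $\mathcal{C},\hat{\mathcal{A}},\hat{\mathcal{B}}$ are collected in a real vector $z\in\mathbb{R}^{3n_1n_2n_3+4\|\mathbf{r}\|_1(n_1+n_2)}$. Let $\mathrm{TV}(\mathcal{C})=\lambda_1\sum_{k=1}^{n_1-1}\|\mathcal{C}(k,:,:)-\mathcal{C}(k+1,:,:)\|_F^2+\lambda_2\sum_{k=1}^{n_2-1}\|\mathcal{C}(:,k,:)-\mathcal{C}(:,k+1,:)\|_F^2$ and $$f(z)=\tfrac12\|\mathcal{A}*_\mu\mathcal{B}-\mathcal{C}\|_F^2+\tfrac{\lambda}{2n_3}\big(\|\hat{\mathcal{A}}\|_F^2+\|\hat{\mathcal{B}}\|_F^2\big)+\mathrm{TV}(\mathcal{C}).$$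 The feasible set is $\Lambda=\{z: P_\Omega(\mathcal{C}-\mathcal{M})=0\}$, and the problem is $\min_{z\in\Lambda}f(z)$. The projected gradient $\Pi_\Lambda(\nabla f(z))$ is the vector obtained from the real gradient $\nabla f(z)$ by replacing each block $\partial f/\partial\mathcal{C}_\alpha$ ($\alpha\in\{\mathbf i,\mathbf j,\mathbf k\}$) by $P_{\Omega^c}(\partial f/\partial\mathcal{C}_\alpha)$ and leaving the blocks for $\hat{\mathcal{A}},\hat{\mathcal{B}}$ unchanged. QRTC sequence: $z^0=(\mathcal{C}^0,\hat{\mathcal{A}}^0,\hat{\mathcal{B}}^0)\in\Lambda$ is arbitrary, and for $t=1,2,\dots$ (no stopping), $z^t=(\mathcal{C}^t,\hat{\mathcal{A}}^t,\hat{\mathcal{B}}^t)$ where: (1) $\mathcal{C}^t$ is the minimizer, over $\mathcal{C}$ with $\Re(\mathcal{C})=0$ and $P_\Omega(\mathcal{C}-\mathcal{M})=0$, of $\frac12\|\mathcal{A}^{t-1}*_\mu\mathcal{B}^{t-1}-\mathcal{C}\|_F^2+\mathrm{TV}(\mathcal{C})+\sum_{\alpha\in\{\mathbf i,\mathbf j,\mathbf k\}}\langle\delta^t_\alpha,\mathcal{C}_\alpha\rangle$, for some error tensor $\delta^t=\delta^t_{\mathbf i}\mathbf{i}+\delta^t_{\mathbf j}\mathbf{j}+\delta^t_{\mathbf k}\mathbf{k}$ (so $\Re(\delta^t)=0$) with $P_\Omega(\delta^t)=0$ and $\|P_{\Omega^c}(\delta^t)\|_F\le\frac14\|\mathcal{C}^t-\mathcal{C}^{t-1}\|_F$;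 (2) for each $l$, $\hat{\mathcal{A}}^{t,(l)}=\big(\hat{\mathcal{C}}^{t,(l)}(\hat{\mathcal{B}}^{t-1,(l)})^*+\beta\hat{\mathcal{A}}^{t-1,(l)}\big)\big(\hat{\mathcal{B}}^{t-1,(l)}(\hat{\mathcal{B}}^{t-1,(l)})^*+(\lambda+\beta)I\big)^{-1}$; (3) for each $l$, $\hat{\mathcal{B}}^{t,(l)}=\big((\hat{\mathcal{A}}^{t,(l)})^*\hat{\mathcal{A}}^{t,(l)}+(\lambda+\beta)I\big)^{-1}\big((\hat{\mathcal{A}}^{t,(l)})^*\hat{\mathcal{C}}^{t,(l)}+\beta\hat{\mathcal{B}}^{t-1,(l)}\big)$. *)

(* Defs.v *)
From HB Require Import structures.
From mathcomp Require Import all_boot all_order all_algebra.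
From mathcomp Require Import ring.
From mathcomp Require Import all_classical all_reals all_analysis.

Set Implicit Arguments.
Unset Strict Implicit.
Unset Printing Implicit Defensive.

Import Order.TTheory GRing.Theory Num.Theory.
Import numFieldNormedType.Exports.

Local Open Scope classical_set_scope.
Local Open Scope ring_scope.

(* Quat a b c d is a + b i + c j + d k *)
Record quat (R : Type) := Quat { qre : R; qi : R; qj : R; qk : R }.

Definition quat_to_prod (R : Type) (x : quat R) : R * R * R * R :=
  (qre x, qi x, qj x, qk x).
Definition prod_to_quat (R : Type) (x : R * R * R * R) : quat R :=
  Quat x.1.1.1 x.1.1.2 x.1.2 x.2.
Lemma quat_to_prodK (R : Type) : cancel (@quat_to_prod R) (@prod_to_quat R).
Proof. by case. Qed.

HB.instance Definition _ (R : choiceType) :=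
  Choice.copy (quat R) (can_type (@quat_to_prodK R)).

Section QuaternionRing.
Variable R : comNzRingType.
Implicit Types x y : quat R.

Definition addq x y :=
  Quat (qre x + qre y) (qi x + qi y) (qj x + qj y) (qk x + qk y).
Definition oppq x := Quat (- qre x) (- qi x) (- qj x) (- qk x).
Definition mulq x y :=
  Quat (qre x * qre y - qi x * qi y - qj x * qj y - qk x * qk y)
       (qre x * qi y + qi x * qre y + qj x * qk y - qk x * qj y)
       (qre x * qj y - qi x * qk y + qj x * qre y + qk x * qi y)
       (qre x * qk y + qi x * qj y - qj x * qi y + qk x * qre y).
Definition qreal (a : R) : quat R := Quat a 0 0 0.

Lemma addqA : associative addq.
Proof. by move=> [? ? ? ?] [? ? ? ?] [? ? ? ?]; rewrite /addq /= !addrA. Qed.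
Lemma addqC : commutative addq.
Proof. by move=> [a b c d] [a' b' c' d']; congr Quat; exact: addrC. Qed.
Lemma add0q : left_id (qreal 0) addq.
Proof. by move=> [? ? ? ?]; rewrite /addq /= !add0r. Qed.
Lemma addNq : left_inverse (qreal 0) oppq addq.
Proof. by move=> [? ? ? ?]; rewrite /addq /= !addNr. Qed.

HB.instance Definition _ :=
  GRing.isZmodule.Build (quat R) addqA addqC add0q addNq.

Lemma mulqA : associative mulq.
Proof.
by move=> [? ? ? ?] [? ? ? ?] [? ? ? ?]; rewrite /mulq /=; congr Quat; ring.
Qed.
Lemma mul1q : left_id (qreal 1) mulq.
Proof. by move=> [? ? ? ?]; rewrite /mulq /=; congr Quat; ring. Qed.
Lemma mulq1 : right_id (qreal 1) mulq.
Proof. by move=> [? ? ? ?]; rewrite /mulq /=; congr Quat; ring. Qed.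
Lemma mulqDl : left_distributive mulq addq.
Proof.
by move=> [? ? ? ?] [? ? ? ?] [? ? ? ?]; rewrite /mulq /addq /=; congr Quat; ring.
Qed.
Lemma mulqDr : right_distributive mulq addq.
Proof.
by move=> [? ? ? ?] [? ? ? ?] [? ? ? ?]; rewrite /mulq /addq /=; congr Quat; ring.
Qed.
Lemma oneq_neq0 : qreal 1 != qreal 0.
Proof. by apply/eqP => -[] /eqP; rewrite oner_eq0. Qed.

HB.instance Definition _ := GRing.Zmodule_isNzRing.Build (quat R)
  mulqA mul1q mulq1 mulqDl mulqDr oneq_neq0.

Definition conjq x := Quat (qre x) (- qi x) (- qj x) (- qk x).

Definition normsq x : R := qre x ^+ 2 + qi x ^+ 2 + qj x ^+ 2 + qk x ^+ 2.

End QuaternionRing.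

Definition qimag (R : Type) (a : 'I_3) : quat R -> R :=
  tnth [tuple @qi R; @qj R; @qk R] a.

Definition unit_pure (R : realType) (mu : quat R) :=
  qre mu = 0 /\ normsq mu = 1.

Definition adjq (R : realType) m n (A : 'M[quat R]_(m, n)) : 'M[quat R]_(n, m) :=
  map_mx (@conjq R) A^T.

Definition fnormq (R : realType) m n (A : 'M[quat R]_(m, n)) : R :=
  Num.sqrt (\sum_i \sum_j normsq (A i j)).

(* [invmx] requires commutative scalars; the two-sided inverse is unique when it
   exists, and singular matrices are sent to the default value 0 *)
Definition invqmx (R : realType) m (A : 'M[quat R]_m) : 'M[quat R]_m :=
  xget 0 [set B | A *m B = 1%:M /\ B *m A = 1%:M].

Notation tensor T n1 n2 n3 := {ffun 'I_n1 * 'I_n2 * 'I_n3 -> T}.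

Section Tensors.
Variables (R : realType) (n1 n2 n3 : nat).
Implicit Types (X Y : tensor (quat R) n1 n2 n3) (S : {set 'I_n1 * 'I_n2 * 'I_n3}).

Definition tmap (T U : Type) (f : T -> U) (X : tensor T n1 n2 n3) :
  tensor U n1 n2 n3 := [ffun p => f (X p)].

Definition proj (V : nmodType) S (X : tensor V n1 n2 n3) : tensor V n1 n2 n3 :=
  [ffun p => if p \in S then X p else 0].

(* X(k,:,:), X(:,k,:), X(:,:,l) and X(i,j,:) *)
Definition hslice X k : 'M[quat R]_(n2, n3) := \matrix_(j, l) X (k, j, l).
Definition lslice X k : 'M[quat R]_(n1, n3) := \matrix_(i, l) X (i, k, l).
Definition fslice X l : 'M[quat R]_(n1, n2) := \matrix_(i, j) X (i, j, l).
Definition tube X i j : 'cV[quat R]_n3 := \col_l X (i, j, l).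

Definition tnorm X : R := Num.sqrt (\sum_p normsq (X p)).

Definition tdot (X Y : tensor R n1 n2 n3) : R := \sum_p X p * Y p.

(* row and column indices start at 0, hence no shift by 1 in the angle *)
Definition qdft_mx (mu : quat R) n : 'M[quat R]_n :=
  \matrix_(p, q) let a := 2 * pi * (p * q)%N%:R / n%:R in
    qreal (Num.sqrt n%:R)^-1 * (qreal (cos a) - mu * qreal (sin a)).

Definition qdft mu X : tensor (quat R) n1 n2 n3 :=
  [ffun p => (qreal (Num.sqrt n3%:R) *: (qdft_mx mu n3 *m tube X p.1.1 p.1.2))
               p.2 0].

(* A *_mu B, as a function of the families of slices of the QDFTs of A and B;
   it is well defined because qdft mu is bijective for unit pure mu *)
Definition tprod mu (r : 'I_n3 -> nat) (A : forall l, 'M[quat R]_(n1, r l))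
    (B : forall l, 'M[quat R]_(r l, n2)) : tensor (quat R) n1 n2 n3 :=
  xget 0 [set X | forall l, fslice (qdft mu X) l = A l *m B l].

Definition TV (lambda1 lambda2 : R) X : R :=
  lambda1 * \sum_(k < n1) \sum_(k' < n1 | k' == k.+1 :> nat)
    fnormq (hslice X k - hslice X k') ^+ 2 +
  lambda2 * \sum_(k < n2) \sum_(k' < n2 | k' == k.+1 :> nat)
    fnormq (lslice X k - lslice X k') ^+ 2.

End Tensors.

Section Variable_z.
Variables (R : realType) (n1 n2 n3 : nat) (r : 'I_n3 -> nat).

(* z only holds the three imaginary components of C, but all four real components
   of A-hat and B-hat *)
Definition coordC : finType := ('I_3 * ('I_n1 * 'I_n2 * 'I_n3))%type.
Definition coordA (l : 'I_n3) : finType := ('I_4 * ('I_n1 * 'I_(r l)))%type.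
Definition coordB (l : 'I_n3) : finType := ('I_4 * ('I_(r l) * 'I_n2))%type.
Definition coord : finType :=
  (coordC + {l : 'I_n3 & coordA l} + {l : 'I_n3 & coordB l})%type.

Lemma card_coord :
  #|coord| = (3 * n1 * n2 * n3 + 4 * (\sum_l r l) * (n1 + n2))%N.
Proof.
have tag (T : 'I_n3 -> finType) : #|{: {l & T l}}| = (\sum_l #|T l|)%N.
  by rewrite card_tagged sumnE big_map enumT unlock.
rewrite /coord !card_sum !tag !card_prod !card_ord.
under eq_bigr do rewrite !card_prod !card_ord.
under [X in (_ + X)%N]eq_bigr do rewrite !card_prod !card_ord.
rewrite -!big_distrr /= -big_distrl /= mulnDr !mulnA addnA.
by congr (_ + _ + _)%N; rewrite -!mulnA [(n1 * _)%N]mulnC.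
Qed.

Definition zvec := 'rV[R]_#|coord|.
Implicit Types z : zvec.

Definition entry z (c : coord) : R := z 0 (enum_rank c).

Definition zC z (a : 'I_3) : tensor R n1 n2 n3 :=
  [ffun p => entry z (inl (inl (a, p)))].

Definition zCq z : tensor (quat R) n1 n2 n3 :=
  [ffun p => Quat 0 (zC z (inord 0) p) (zC z (inord 1) p) (zC z (inord 2) p)].

Definition zA z (l : 'I_n3) : 'M[quat R]_(n1, r l) :=
  \matrix_(i, j)
    let e (a : 'I_4) := entry z (inl (inr (Tagged coordA (a, (i, j))))) in
    Quat (e (inord 0)) (e (inord 1)) (e (inord 2)) (e (inord 3)).

Definition zB z (l : 'I_n3) : 'M[quat R]_(r l, n2) :=
  \matrix_(i, j)
    let e (a : 'I_4) := entry z (inr (Tagged coordB (a, (i, j)))) in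
    Quat (e (inord 0)) (e (inord 1)) (e (inord 2)) (e (inord 3)).

(* the norm `|z| of the library on row vectors is the sup norm *)
Definition norm2 z : R := Num.sqrt (\sum_c z 0 c ^+ 2).

Definition grad (f : zvec -> R) z : zvec :=
  \row_c 'D_(delta_mx 0 c : zvec) f z.

End Variable_z.

Section Problem.
Variables (R : realType) (n1 n2 n3 : nat) (r : 'I_n3 -> nat).
Variables (mu : quat R) (M : tensor (quat R) n1 n2 n3).
Variable Omega : {set 'I_n1 * 'I_n2 * 'I_n3}.
Variables lambda lambda1 lambda2 beta : R.
Local Notation zvec := (zvec R n1 n2 r).
Implicit Types z : zvec.

Definition objective z : R :=
  2^-1 * tnorm (tprod mu (zA z) (zB z) - zCq z) ^+ 2
  + lambda / (2 * n3%:R) *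
      (\sum_l fnormq (zA z l) ^+ 2 + \sum_l fnormq (zB z l) ^+ 2)
  + TV lambda1 lambda2 (zCq z).

Definition feasible : set zvec := [set z | proj Omega (zCq z - M) = 0].

Definition proj_grad (v : zvec) : zvec :=
  \row_c match enum_val c with
         | inl (inl (a, p)) => proj (~: Omega) (zC v a) p
         | _ => v 0 c
         end.

Definition minimizer (T : Type) (S : set T) (phi : T -> R) (x : T) :=
  S x /\ forall y, S y -> phi x <= phi y.

Definition C_feasible : set (tensor (quat R) n1 n2 n3) :=
  [set C | tmap (@qre R) C = 0 /\ proj Omega (C - M) = 0].

Definition C_objective z (delta C : tensor (quat R) n1 n2 n3) : R :=
  2^-1 * tnorm (tprod mu (zA z) (zB z) - C) ^+ 2 + TV lambda1 lambda2 C
  + \sum_(a < 3) tdot (tmap (qimag a) delta) (tmap (qimag a) C).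

Definition C_update z z' : Prop :=
  exists delta : tensor (quat R) n1 n2 n3,
    [/\ tmap (@qre R) delta = 0,
        proj Omega delta = 0,
        tnorm (proj (~: Omega) delta) <= 4^-1 * tnorm (zCq z' - zCq z)
      & minimizer C_feasible (C_objective z delta) (zCq z')].

Definition A_update z z' : Prop :=
  forall l, let Bl := zB z l in
    zA z' l =
      (fslice (qdft mu (zCq z')) l *m adjq Bl + qreal beta *: zA z l) *m
      invqmx (Bl *m adjq Bl + (qreal (lambda + beta))%:M).

Definition B_update z z' : Prop :=
  forall l, let Al := zA z' l in
    zB z' l =
      invqmx (adjq Al *m Al + (qreal (lambda + beta))%:M) *m
      (adjq Al *m fslice (qdft mu (zCq z')) l + qreal beta *: zB z l).

Definition QRTC_sequence (z : nat -> zvec) : Prop :=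
  feasible (z 0%N) /\
  forall t, [/\ C_update (z t) (z t.+1), A_update (z t) (z t.+1)
              & B_update (z t) (z t.+1)].

Definition KL_inequality (theta : R) (zs : zvec) : Prop :=
  exists2 Z' : set zvec, nbhs zs Z' &
  exists2 K3 : R, 0 < K3 &
  forall z, Z' z -> feasible z ->
    `|objective z - objective zs| `^ theta
      <= K3 * norm2 (proj_grad (grad objective z)).

End Problem.

(* Main.v *)
Require Import Defs.
From HB Require Import structures.
From mathcomp Require Import all_boot all_order all_algebra.
From mathcomp Require Import all_classical all_reals all_analysis.
From mathcomp Require Import ring lra zify.

(** The iteration is a block descent method, and the rates follow from three
    facts about s_t = f(z^t) - f(zs), where zs is the limit.

    Descent: s_t - s_(t+1) >= c |z^(t+1) - z^t|^2.  By Parseval for the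
    quaternion Fourier transform, f is a sum of squared norms of
    A_l B_l - Chat_l and of quadratic terms, so it is exactly quadratic along
    each of the blocks C, A, B.  At the point where a block has just been
    updated, the linear term of the expansion in that block is known from the
    optimality of the update ([C_stationary], [A_stationary],
    [B_stationary]); the quadratic term is nonnegative, and for C it
    is at least twice the loss due to the error allowed in the C-step ([step_descent]).

    Relative error: |Pi(grad f)(z^(t+1))| <= K |z^(t+1) - z^t|.  Each
    coordinate of the gradient is controlled by stationarity at the
    intermediate point where its block was updated, and the gradient is
    Lipschitz on the bounded set that contains the sequence
    ([relative_error]).

    Kurdyka-Lojasiewicz: combined with the two previous facts it gives
    s_(t+1)^(2 theta) <= C (s_t - s_(t+1)).  For theta <= 1/2 this forces
    s_t to decrease geometrically, hence also the steps, whose lengths are at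
    most sqrt(s_t / c), and their tail sums.  For theta > 1/2 it
    forces s_t = O(t^(-1/(2 theta - 1))), and the path from t to 2t has
    length at most sqrt(t s_t / c) = O(t^(-(1 - theta)/(2 theta - 1)));
    summing over dyadic blocks gives the distance to the limit
    ([KL_linear_rate], [KL_sublinear_rate]). *)

Import Order.TTheory GRing.Theory Num.Theory.
Import numFieldNormedType.Exports.

Local Open Scope classical_set_scope.
Local Open Scope ring_scope.

Set Implicit Arguments.
Unset Strict Implicit.

(** * Convergence rates from descent and a relative error bound *)

Section Rates.
Variable R : realType.

Lemma le0_of_frequently_le (e : nat -> R) (x : R) :
  e @ \oo --> 0 -> (forall N, exists2 n, (N <= n)%N & x <= e n) -> x <= 0.
Proof.
move=> e0 ex; rewrite leNgt; apply/negP => x0.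
have /cvgrPdist_lt /(_ x x0) [N _ HN] := e0.
have [n Nn] := ex N; have := HN n Nn.
by rewrite sub0r normrN => /(le_lt_trans (ler_norm _)) /le_lt_trans h /h; rewrite ltxx.
Qed.

Lemma nonincreasing_cvg0_ge0 (s : nat -> R) :
  (forall t, s t.+1 <= s t) -> s @ \oo --> 0 -> forall t, 0 <= s t.
Proof.
move=> smon s0 t; rewrite -oppr_le0.
apply: (@le0_of_frequently_le (fun n => - s n)).
  by rewrite -oppr0; apply: cvgN.
move=> N; exists (maxn N t); first exact: leq_maxl.
rewrite lerN2; move: (maxn N t) (leq_maxr N t).
exact: (homo_leq (r := fun x y => y <= x) (@lexx _ _)
  (fun x y z h1 h2 => le_trans h2 h1) smon).
Qed.

(** The defect [|z t - zs| - C / (1 - q) * q ^ t] is nondecreasing in [t] by the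
    triangle inequality and lies below a sequence that tends to 0; hence it
    is nonpositive. *)
Lemma dist_to_limit_geometric (V : normedModType R) (z : nat -> V) zs (C q : R) :
  0 <= C -> 0 < q < 1 -> z @ \oo --> zs ->
  (forall t, `|z t.+1 - z t| <= C * q ^+ t) ->
  forall t, `|z t - zs| <= C / (1 - q) * q ^+ t.
Proof.
move=> C0 /andP[q0 q1] zcv step.
have q1' : 0 < 1 - q by rewrite subr_gt0.
have e0 : (fun t => `|z t - zs|) @ \oo --> 0.
  by rewrite -(@normr0 _ V) -(subrr zs); apply: cvg_norm; apply: cvgB => //; exact: cvg_cst.
pose u t := `|z t - zs| - C / (1 - q) * q ^+ t.
have umon t : u t <= u t.+1.
  rewrite /u.
  have -> : C / (1 - q) * q ^+ t.+1 = C / (1 - q) * q ^+ t - C * q ^+ t.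
    by rewrite exprS; field; rewrite gt_eqF.
  have := ler_normD (z t - z t.+1) (z t.+1 - zs).
  by rewrite subrKA (distrC (z t) (z t.+1)); have := step t; lra.
move=> t; rewrite -subr_le0; apply: (le0_of_frequently_le e0) => N.
exists (maxn N t); first exact: leq_maxl.
apply: (@le_trans _ _ (u (maxn N t))).
  apply: (homo_leq (r := fun x y => x <= y) (@lexx _ _) _ umon) (leq_maxr N t).
  by move=> x y w; apply: le_trans.
by rewrite /u gerBl mulr_ge0 ?exprn_ge0 ?divr_ge0// ltW.
Qed.

(** The same monotone defect as in [dist_to_limit_geometric], read along the
    times [t], [2t], [4t], and so on, where [t ^ -alpha] becomes geometric
    with ratio [2 ^ -alpha]. *)
Lemma dist_to_limit_dyadic (V : normedModType R) (z : nat -> V) zs (D alpha : R) :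
  0 <= D -> 0 < alpha -> z @ \oo --> zs ->
  (forall t, (0 < t)%N ->
     `|z t.*2 - z t| <= D * t%:R `^ (- alpha)) ->
  forall t, (0 < t)%N ->
     `|z t - zs| <= D / (1 - 2 `^ (- alpha)) * t%:R `^ (- alpha).
Proof.
move=> D0 a0 zcv step t t0.
set w := 2 `^ (- alpha).
have w1 : 0 < 1 - w.
  rewrite subr_gt0 /w powRN invf_lt1 ?powR_gt0//.
  have {1}-> : 1 = 1 `^ alpha :> R by rewrite powR1.
  by rewrite gt0_ltr_powR ?nnegrE ?ler01 ?ler0n// ltr1n.
have e0 : (fun t => `|z t - zs|) @ \oo --> 0.
  by rewrite -(@normr0 _ V) -(subrr zs); apply: cvg_norm; apply: cvgB => //; exact: cvg_cst.
pose E := D / (1 - w).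
pose tau k := (2 ^ k * t)%N.
have tauS k : tau k.+1 = (tau k).*2 by rewrite /tau expnS -mulnA mul2n.
have tau_ge k : (t <= tau k)%N by rewrite leq_pmull// expn_gt0.
pose u k := `|z (tau k) - zs| - E * (tau k)%:R `^ (- alpha).
have umon k : u k <= u k.+1.
  rewrite /u tauS -mul2n natrM powRM ?ler0n// -/w.
  have -> : E * (w * (tau k)%:R `^ (- alpha)) =
     E * (tau k)%:R `^ (- alpha) - D * (tau k)%:R `^ (- alpha).
    by rewrite /E; field; rewrite gt_eqF.
  have := ler_normD (z (tau k) - z (2 * tau k)%N) (z (2 * tau k)%N - zs).
  rewrite subrKA (distrC (z (tau k)) (z (2 * tau k)%N)) mul2n.
  have := step (tau k) (leq_trans t0 (tau_ge k)).
  lra.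
rewrite -subr_le0; apply: (le0_of_frequently_le e0) => N.
exists (tau N).
  by rewrite (leq_trans (ltnW (ltn_expl N (ltnSn 1))))// leq_pmulr.
apply: (@le_trans _ _ (u N)).
  have -> : `|z t - zs| - E * t%:R `^ (- alpha) = u 0%N by rewrite /u /tau mul1n.
  apply: (homo_leq (r := fun x y => x <= y) (@lexx _ _) _ umon) (leq0n N).
  by move=> x y v; apply: le_trans.
by rewrite /u gerBl mulr_ge0 ?powR_ge0 ?divr_ge0// ltW.
Qed.

Section Decrease.
Variables (s : nat -> R) (C theta : R) (T : nat).
Hypothesis C_gt0 : 0 < C.
Hypothesis s_noninc : forall t, s t.+1 <= s t.
Hypothesis s_cvg : s @ \oo --> 0.
Hypothesis s_rec : forall t, (T <= t)%N ->
  s t.+1 `^ (2 * theta) <= C * (s t - s t.+1).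

Let s_ge0 t : 0 <= s t.
Proof. exact: nonincreasing_cvg0_ge0. Qed.

Let s_le m n : (m <= n)%N -> s n <= s m.
Proof.
exact: (homo_leq (r := fun x y => y <= x) (@lexx _ _)
  (fun x y z h1 h2 => le_trans h2 h1) s_noninc).
Qed.

(** As soon as [s < 1], the exponent [2 theta <= 1] gives
    [s <= s ^ (2 theta)], and the recursion becomes the linear one
    [(1 + C) s_(t+1) <= C s_t]. *)
Lemma linear_decrease : 0 < theta <= 2^-1 ->
  exists G q : R, [/\ 0 <= G, 0 < q < 1 & forall t, s t <= G * q ^+ t].
Proof.
move=> /andP[th0 th2].
have [N _ HN] : \forall t \near \oo, s t < 1 by apply: (cvgr_lt _ s_cvg).
pose T1 := maxn N T.
pose q := C / (1 + C).
have q0 : 0 < q by rewrite divr_gt0 ?addr_gt0.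
have q1 : q < 1 by rewrite ltr_pdivrMr ?addr_gt0//; lra.
have step t : (T1 <= t)%N -> s t.+1 <= q * s t.
  move=> T1t; rewrite mulrAC ler_pdivlMr ?addr_gt0//.
  have h1 : s t.+1 <= s t.+1 `^ (2 * theta).
    have [->|sn0] := eqVneq (s t.+1) 0; first exact: powR_ge0.
    apply: ger1_powR; last lra.
    rewrite lt0r sn0 s_ge0/= ltW// HN//=.
    by rewrite (leq_trans _ (leqnSn t))// (leq_trans (leq_maxl _ _) T1t).
  have := s_rec (leq_trans (leq_maxr _ _) T1t); lra.
exists (s 0%N / q ^+ T1), q; rewrite q0 q1 divr_ge0 ?exprn_ge0 ?(ltW q0)//; split => //.
have small t : (t <= T1)%N -> s t <= s 0%N / q ^+ T1 * q ^+ t.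
  move=> tT; rewrite mulrAC ler_pdivlMr ?exprn_gt0//.
  by apply: ler_pM; rewrite ?exprn_ge0 ?(ltW q0) ?s_le// ler_wiXn2l// ltW.
elim=> [|t IH]; first exact: small.
have [tT|Tt] := leqP t.+1 T1; first exact: small.
by apply: (le_trans (step _ Tt)); rewrite exprS mulrCA ler_wpM2l// ltW.
Qed.

Lemma sum_decrease m n : 0 <= theta -> (T <= m)%N ->
  n%:R * s (m + n) `^ (2 * theta) <= C * (s m - s (m + n)).
Proof.
move=> th0 Tm; elim: n => [|n IH]; first by rewrite addn0 subrr mul0r mulr0.
rewrite addnS -natr1.
have := s_rec (leq_trans Tm (leq_addr n m)).
have h : s (m + n).+1 `^ (2 * theta) <= s (m + n) `^ (2 * theta).
  by apply: ge0_ler_powR => //; rewrite ?nnegrE// mulr_ge0.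
by have := ler_wpM2l (ler0n R n) h; lra.
Qed.

(** Strong induction from [t / 2] to [t]: summing the recursion over the
    second half of the times up to [t] bounds [(t / 2) s_t ^ (2 theta)] by
    [C s_(t / 2)], and the claimed power of [t] is the one that reproduces
    itself under this inequality. *)
Lemma sublinear_decrease : 2^-1 < theta < 1 ->
  exists2 D : R, 0 <= D &
    forall t, (0 < t)%N -> s t <= D * t%:R `^ (- (2 * theta - 1)^-1).
Proof.
move=> /andP[th2 th1].
set q := 2 * theta - 1.
have q0 : 0 < q by rewrite /q; lra.
have pE : 2 * theta = 1 + q by rewrite /q; ring.
pose T1 := maxn T 1.
(* [D1] covers the times t <= 2 T1, where s_t <= s_0; [D2] satisfies
   [D2 ^ q = C * 3 ^ ((1 + q) / q)], as the induction step requires, the factor 3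
   coming from t <= 3 (t / 2). *)
pose D1 := s 0%N * (T1.*2)%:R `^ q^-1.
pose D2 := (C * 3 `^ ((1 + q) / q)) `^ q^-1.
have D10 : 0 <= D1 by rewrite mulr_ge0 ?powR_ge0.
have D20 : 0 < D2 by rewrite powR_gt0// mulr_gt0// powR_gt0.
exists (D1 + D2); first by rewrite addr_ge0// ltW.
elim/ltn_ind => t IH t0.
have [tT|Tt] := leqP t T1.*2.
  apply: (@le_trans _ _ (s 0%N)); first exact: s_le.
  rewrite powRN ler_pdivlMr ?powR_gt0 ?ltr0n//.
  apply: (@le_trans _ _ D1); last by rewrite lerDl ltW.
  rewrite /D1 ler_wpM2l// ge0_ler_powR ?nnegrE ?ler0n ?ler_nat//.
  by rewrite invr_ge0 ltW.
set D := D1 + D2.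
have D0 : 0 < D by rewrite ltr_wpDl.
pose m := t./2.
have T1m : (T1 <= m)%N by rewrite /m -(doubleK T1) half_leq// ltnW.
have m0 : (0 < m)%N by rewrite (leq_trans _ T1m)// leq_max orbT.
have mt : (m < t)%N by rewrite /m -divn2 ltn_Pdiv.
have Dq : C * 3 `^ ((1 + q) / q) <= D `^ q.
  apply: (@le_trans _ _ (D2 `^ q)).
    by rewrite /D2 -powRrM mulVf ?gt_eqF// powRr1// mulr_ge0 ?powR_ge0 ?ltW.
  by apply: ge0_ler_powR; rewrite ?nnegrE ?(ltW q0) ?(ltW D0) ?(ltW D20) ?lerDr.
rewrite leNgt; apply/negP => bad.
have := @sum_decrease m (t - m) ltac:(lra) (leq_trans (leq_maxl _ _) T1m).
rewrite subnKC 1?ltnW// pE => main.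
have mR : 0 < m%:R :> R by rewrite ltr0n.
have m_le : m%:R <= (t - m)%:R :> R.
  by rewrite ler_nat /m; clear; lia.
have t3 : t%:R <= 3 * m%:R :> R.
  by rewrite -natrM ler_nat; move: m0; rewrite /m; clear; lia.
have lower : (D * (3 * m%:R) `^ (- q^-1)) `^ (1 + q) < s t `^ (1 + q).
  apply: gt0_ltr_powR; rewrite ?nnegrE ?mulr_ge0 ?powR_ge0 ?(ltW D0)//; first lra.
  apply: le_lt_trans bad; rewrite ler_wpM2l ?(ltW D0)// !powRN lef_pV2 ?posrE ?powR_gt0 ?mulr_gt0 ?ltr0n//.
  by rewrite ge0_ler_powR ?nnegrE ?invr_ge0 ?ler0n ?(ltW q0)// mulr_ge0.
have upper : m%:R * s t `^ (1 + q) <= C * (D * m%:R `^ (- q^-1)).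
  apply: (@le_trans _ _ ((t - m)%:R * s t `^ (1 + q))).
    by rewrite ler_wpM2r ?powR_ge0.
  apply: (le_trans main); rewrite ler_wpM2l ?(ltW C_gt0)//.
  apply: (@le_trans _ _ (s m)); first by rewrite lerBlDr lerDl.
  exact: IH.
have : m%:R * (D * (3 * m%:R) `^ (- q^-1)) `^ (1 + q) < C * (D * m%:R `^ (- q^-1)).
  by apply: lt_le_trans upper; rewrite ltr_pM2l.
rewrite powRM ?powR_ge0 ?(ltW D0)// -powRrM powRM ?ler0n//.
have -> : - q^-1 * (1 + q) = - ((1 + q) / q) by field; rewrite gt_eqF.
have -> : m%:R `^ (- ((1 + q) / q)) = m%:R^-1 * m%:R `^ (- q^-1) :> R.
  have -> : - ((1 + q) / q) = - 1 - q^-1 by field; rewrite gt_eqF.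
  by rewrite powRD ?powR_inv1 ?ler0n// (gt_eqF mR) implybT.
rewrite powRD ?powRr1 ?(ltW D0)//; last by rewrite (gt_eqF D0) implybT.
rewrite (powRN 3); set X := 3 `^ _ in Dq *.
have X0 : 0 < X by apply: powR_gt0.
set Y := m%:R `^ _; have Y0 : 0 < Y by apply: powR_gt0.
have -> : m%:R * (D * D `^ q * (X^-1 * (m%:R^-1 * Y))) = D * Y * (D `^ q / X).
  by field; rewrite !gt_eqF.
have -> : C * (D * Y) = D * Y * C by ring.
rewrite ltr_pM2l ?mulr_gt0// ltr_pdivrMr// => /lt_le_trans /(_ Dq).
by rewrite ltxx.
Qed.

End Decrease.

Section Descent.
Variables (V : normedModType R) (z : nat -> V) (zs : V) (s : nat -> R).
Variables (c K theta : R) (T : nat).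
Hypothesis c_gt0 : 0 < c.
Hypothesis K_gt0 : 0 < K.
Hypothesis z_cvg : z @ \oo --> zs.
Hypothesis s_cvg : s @ \oo --> 0.
Hypothesis descent : forall t, c * `|z t.+1 - z t| ^+ 2 <= s t - s t.+1.
Hypothesis relative_error : forall t, (T <= t)%N ->
  s t.+1 `^ theta <= K * `|z t.+1 - z t|.

Let s_noninc t : s t.+1 <= s t.
Proof.
rewrite -subr_ge0; apply: le_trans (descent t).
by rewrite mulr_ge0 ?exprn_ge0// ltW.
Qed.

Let s_ge0 t : 0 <= s t.
Proof. exact: nonincreasing_cvg0_ge0. Qed.

Let C_gt0 : 0 < K ^+ 2 / c.
Proof. by rewrite divr_gt0// exprn_gt0. Qed.

Let s_rec t : (T <= t)%N ->
  s t.+1 `^ (2 * theta) <= K ^+ 2 / c * (s t - s t.+1).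
Proof.
move=> Tt; rewrite mulrC powRrM powR_mulrn ?powR_ge0//.
apply: (@le_trans _ _ ((K * `|z t.+1 - z t|) ^+ 2)).
  by rewrite ler_sqr ?nnegrE ?powR_ge0 ?mulr_ge0 ?(ltW K_gt0)// relative_error.
rewrite exprMn -mulrA ler_pM2l ?exprn_gt0// ler_pdivlMl//.
Qed.

(** Geometric decrease of [s] bounds each step by a geometric sequence whose
    ratio is the square root of that of [s]. *)
Lemma KL_linear_rate : 0 < theta <= 2^-1 ->
  exists G q : R, [/\ 0 <= G, 0 < q < 1 & forall t, `|z t - zs| <= G * q ^+ t].
Proof.
move=> th; have [G [q [G0 /andP[q0 q1] sG]]] :=
  linear_decrease C_gt0 s_noninc s_cvg s_rec th.
pose rho := Num.sqrt q.
have rho01 : 0 < rho < 1.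
  by rewrite sqrtr_gt0 q0/= -sqrtr1 ltr_sqrt.
have /andP[rho0 rho1] := rho01.
exists (Num.sqrt (G / c) / (1 - rho)), rho; split => //.
  by rewrite divr_ge0 ?sqrtr_ge0// subr_ge0 ltW.
apply: dist_to_limit_geometric => // t.
have Gc : 0 <= G / c by rewrite divr_ge0// ltW.
rewrite -ler_sqr ?nnegrE ?mulr_ge0 ?sqrtr_ge0 ?exprn_ge0 ?(ltW rho0)//.
rewrite exprMn sqr_sqrtr// exprAC sqr_sqrtr ?(ltW q0)// mulrAC ler_pdivlMr// mulrC.
by apply: (le_trans (descent t)); apply: le_trans (sG t); rewrite lerBlDr lerDl.
Qed.

(** By AM-GM each step satisfies [2 a <= x + a ^ 2 / x] for any weight
    [x > 0], and the descent inequality makes the sum of the [a ^ 2]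
    telescope. *)
Lemma path_length x m n : 0 < x ->
  2 * `|z (m + n) - z m| <= n%:R * x + (s m - s (m + n)) / (c * x).
Proof.
move=> x0; elim: n => [|n IH]; first by rewrite addn0 !subrr normr0 mulr0 mul0r mul0r addr0.
rewrite addnS -natr1.
have cx : 0 < c * x by rewrite mulr_gt0.
set a := `|z (m + n).+1 - z (m + n)|.
have step : 2 * a <= x + (s (m + n) - s (m + n).+1) / (c * x).
  apply: (@le_trans _ _ (x + a ^+ 2 / x)).
    rewrite -(ler_pM2r x0) [leRHS]mulrDl divfK ?gt_eqF//.
    by have := sqr_ge0 (a - x); lra.
  have -> : a ^+ 2 / x = c * a ^+ 2 / (c * x) by field; rewrite !gt_eqF.
  by rewrite lerD2l ler_wpM2r ?invr_ge0 ?(ltW cx)//; exact: descent.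
have := ler_normD (z (m + n).+1 - z (m + n)) (z (m + n) - z m).
rewrite subrKA -/a.
have -> : s m - s (m + n).+1 = (s m - s (m + n)) + (s (m + n) - s (m + n).+1).
  by rewrite subrKA.
by rewrite mulrDl; lra.
Qed.

Lemma KL_sublinear_rate : 2^-1 < theta < 1 ->
  exists2 G : R, 0 <= G & forall t, (0 < t)%N ->
   `|z t - zs| <= G * t%:R `^ (- ((1 - theta) / (2 * theta - 1))).
Proof.
move=> th; have [D D0 sD] := sublinear_decrease C_gt0 s_noninc s_cvg s_rec th.
have /andP[th2 th1] := th.
set q := 2 * theta - 1 in sD *.
have q0 : 0 < q by rewrite /q; lra.
set alpha := (1 - theta) / q.
have a0 : 0 < alpha by rewrite divr_gt0// subr_gt0.
pose E := 2^-1 * (1 + D / c).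
have E0 : 0 <= E by rewrite mulr_ge0// addr_ge0// divr_ge0// ltW.
have dyadic t : (0 < t)%N -> `|z t.*2 - z t| <= E * t%:R `^ (- alpha).
  move=> t0; have tR : 0 < t%:R :> R by rewrite ltr0n.
  (* this weight balances the two terms of path_length for n = t: both are of
     order t ^ -alpha *)
  pose x : R := t%:R `^ (- alpha - 1).
  have x0 : 0 < x by apply: powR_gt0.
  have := path_length t t x0; rewrite addnn.
  have -> : t%:R * x = t%:R `^ (- alpha).
    by rewrite -[X in X * _]powRr1 ?ler0n// -powRD ?(gt_eqF tR) ?implybT//; congr powR; ring.
  have : (s t - s t.*2) / (c * x) <= D / c * t%:R `^ (- alpha).
    rewrite ler_pdivrMr ?mulr_gt0//.
    have -> : D / c * t%:R `^ (- alpha) * (c * x) = D * (t%:R `^ (- alpha) * x).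
      by field; rewrite gt_eqF.
    have -> : t%:R `^ (- alpha) * x = t%:R `^ (- q^-1).
      rewrite -powRD ?(gt_eqF tR) ?implybT//; congr powR.
      by rewrite /alpha /q; field; rewrite -/q gt_eqF.
    by apply: le_trans (sD t t0); rewrite lerBlDr lerDl.
  by rewrite /E; lra.
exists (E / (1 - 2 `^ (- alpha))).
  rewrite divr_ge0// subr_ge0 powRN invf_le1 ?powR_gt0//.
  have {1}-> : 1 = 1 `^ alpha :> R by rewrite powR1.
  by rewrite ge0_ler_powR ?nnegrE ?ler01 ?ler0n ?(ltW a0)// ler1n.
exact: (dist_to_limit_dyadic E0 a0 z_cvg dyadic).
Qed.
End Descent.
End Rates.

(** * Quaternion matrices *)

Section QuaternionMatrices.
Variable R : realType.
Implicit Types x y w : quat R.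

Lemma quatP x y :
  qre x = qre y -> qi x = qi y -> qj x = qj y -> qk x = qk y -> x = y.
Proof. by case: x y => [? ? ? ?] [? ? ? ?] /= -> -> -> ->. Qed.

Lemma quatD (a b c d a' b' c' d' : R) :
  Quat a b c d + Quat a' b' c' d' = Quat (a + a') (b + b') (c + c') (d + d').
Proof. by []. Qed.

Lemma quatM x y : x * y = Defs.mulq x y.
Proof. by []. Qed.

Lemma qrealZ (c a1 a2 a3 a4 : R) :
  qreal c * Quat a1 a2 a3 a4 = Quat (c * a1) (c * a2) (c * a3) (c * a4).
Proof. by apply: quatP; rewrite ?quatM /=; ring. Qed.

Lemma qreal_comm c x : qreal c * x = x * qreal c.
Proof. by case: x => *; apply: quatP; rewrite ?quatM /=; ring. Qed.

Lemma qrealM (a b : R) : qreal (a * b) = qreal a * qreal b.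
Proof. by apply: quatP; rewrite ?quatM /=; ring. Qed.

(** The Euclidean inner product of R^4, that is the real part of
    [x * conjq y]; multiplication by a quaternion on either side has
    multiplication by its conjugate as adjoint. *)
Definition qdot x y : R :=
  qre x * qre y + qi x * qi y + qj x * qj y + qk x * qk y.

Lemma qdotC x y : qdot x y = qdot y x.
Proof. by rewrite /qdot; ring. Qed.

Lemma qdotDr x y w : qdot x (y + w) = qdot x y + qdot x w.
Proof. by case: y w => [????] [????]; rewrite quatD /qdot /=; ring. Qed.

Lemma qdot0r x : qdot x 0 = 0.
Proof. by rewrite /qdot /=; ring. Qed.

Lemma qdot_sumr x I (r : seq I) (P : pred I) (F : I -> quat R) :
  qdot x (\sum_(i <- r | P i) F i) = \sum_(i <- r | P i) qdot x (F i).
Proof. by apply: big_morph; [exact: qdotDr | exact: qdot0r]. Qed.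

Lemma qdotZr x c y : qdot x (qreal c * y) = c * qdot x y.
Proof. by case: y => *; rewrite qrealZ /qdot /=; ring. Qed.

Lemma qdotMl x y w : qdot (x * y) w = qdot x (w * conjq y).
Proof. by rewrite /qdot quatM /=; ring. Qed.

Lemma qdotMr x y w : qdot (x * y) w = qdot y (conjq x * w).
Proof. by rewrite /qdot quatM /=; ring. Qed.

Lemma normsqE x : normsq x = qdot x x.
Proof. by rewrite /normsq /qdot !expr2. Qed.

Lemma normsq_ge0 x : 0 <= normsq x.
Proof. by rewrite /normsq !addr_ge0 ?sqr_ge0. Qed.

Lemma normsq_eq0 x : normsq x = 0 -> x = 0.
Proof.
rewrite /normsq => h.
have := sqr_ge0 (qre x); have := sqr_ge0 (qi x).
have := sqr_ge0 (qj x); have := sqr_ge0 (qk x).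
move=> h1 h2 h3 h4.
by apply: quatP; apply/eqP; rewrite -sqrf_eq0; apply/eqP => /=; lra.
Qed.

Section Matrices.
Variables m n : nat.
Implicit Types A B C : 'M[quat R]_(m, n).

Definition mdot A B : R := \sum_i \sum_j qdot (A i j) (B i j).

Lemma mdotC A B : mdot A B = mdot B A.
Proof. by apply: eq_bigr => i _; apply: eq_bigr => j _; exact: qdotC. Qed.

Lemma mdotDr A B C : mdot A (B + C) = mdot A B + mdot A C.
Proof.
rewrite -big_split; apply: eq_bigr => i _; rewrite -big_split.
by apply: eq_bigr => j _; rewrite mxE qdotDr.
Qed.

Lemma mdotZr A c B : mdot A (qreal c *: B) = c * mdot A B.
Proof.
rewrite mulr_sumr; apply: eq_bigr => i _; rewrite mulr_sumr.
by apply: eq_bigr => j _; rewrite mxE qdotZr.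
Qed.

Lemma scalemx_qrealN1 A : qreal (-1) *: A = - A.
Proof.
apply/matrixP => i j; rewrite !mxE; case: (A i j) => *.
by rewrite qrealZ; apply: quatP; rewrite /= mulN1r.
Qed.

Lemma mdotNr A B : mdot A (- B) = - mdot A B.
Proof. by rewrite -scalemx_qrealN1 mdotZr mulN1r. Qed.

Lemma mdotDl A B C : mdot (B + C) A = mdot B A + mdot C A.
Proof. by rewrite !(mdotC _ A) mdotDr. Qed.

Lemma mdotZl A c B : mdot (qreal c *: B) A = c * mdot B A.
Proof. by rewrite !(mdotC _ A) mdotZr. Qed.

Lemma mdotNl A B : mdot (- B) A = - mdot B A.
Proof. by rewrite !(mdotC _ A) mdotNr. Qed.

Lemma mdot0r A : mdot A 0 = 0.
Proof. by rewrite /mdot big1// => i _; rewrite big1// => j _; rewrite mxE qdot0r. Qed.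

Lemma mdot0l A : mdot 0 A = 0.
Proof. by rewrite mdotC mdot0r. Qed.

Lemma mdot_ge0 A : 0 <= mdot A A.
Proof.
by apply: sumr_ge0 => i _; apply: sumr_ge0 => j _; rewrite -normsqE normsq_ge0.
Qed.

Lemma normsq_le_mdot A i j : normsq (A i j) <= mdot A A.
Proof.
rewrite normsqE /mdot (bigD1 i)//= (bigD1 j)//= -addrA lerDl addr_ge0//.
  by apply: sumr_ge0 => k _; rewrite -normsqE normsq_ge0.
by apply: sumr_ge0 => k _; apply: sumr_ge0 => l _; rewrite -normsqE normsq_ge0.
Qed.

Lemma mdot_eq0 A : mdot A A = 0 -> A = 0.
Proof.
move=> A0; apply/matrixP => i j; rewrite mxE; apply: normsq_eq0.
by apply/eqP; rewrite eq_le normsq_ge0 -A0 normsq_le_mdot.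
Qed.

Lemma fnormq_sqr A : fnormq A ^+ 2 = mdot A A.
Proof.
rewrite /fnormq sqr_sqrtr.
  by apply: eq_bigr => i _; apply: eq_bigr => j _; rewrite normsqE.
by apply: sumr_ge0 => i _; apply: sumr_ge0 => j _; rewrite normsq_ge0.
Qed.

Lemma adjqK A : adjq (adjq A) = A.
Proof.
by apply/matrixP => i j; rewrite !mxE; apply: quatP; rewrite /= ?opprK.
Qed.

Lemma scalemx_qrealA a b A : qreal a *: (qreal b *: A) = qreal (a * b) *: A.
Proof. by rewrite scalerA qrealM. Qed.

Lemma mulmx_qreal (c : R) A : A *m (qreal c)%:M = qreal c *: A.
Proof.
apply/matrixP => i j; rewrite !mxE (bigD1 j)//= big1 => [|k kj].
  by rewrite !mxE eqxx mulr1n addr0 qreal_comm.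
by rewrite !mxE (negPf kj) mulr0n mulr0.
Qed.

End Matrices.

(** Right multiplication by [B] and right multiplication by its conjugate
    transpose are adjoint; with [mdot_mulr], this turns the normal equations
    of the A- and B-steps into statements on directional derivatives. *)
Lemma mdot_mull m n p (A : 'M[quat R]_(m, n)) (B : 'M[quat R]_(n, p)) C :
  mdot (A *m B) C = mdot A (C *m adjq B).
Proof.
apply: eq_bigr => i _.
transitivity (\sum_k \sum_j qdot (A i j) (C i k * conjq (B j k))).
  apply: eq_bigr => k _; rewrite !mxE qdotC qdot_sumr.
  by apply: eq_bigr => j _; rewrite qdotC qdotMl.
rewrite exchange_big; apply: eq_bigr => j _; rewrite !mxE qdot_sumr.
by apply: eq_bigr => k _; rewrite !mxE.
Qed.

Lemma mdot_mulr m n p (A : 'M[quat R]_(m, n)) (B : 'M[quat R]_(n, p)) C :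
  mdot (A *m B) C = mdot B (adjq A *m C).
Proof.
rewrite /mdot.
transitivity (\sum_i \sum_k \sum_j qdot (B j k) (conjq (A i j) * C i k)).
  apply: eq_bigr => i _; apply: eq_bigr => k _; rewrite !mxE qdotC qdot_sumr.
  by apply: eq_bigr => j _; rewrite qdotC qdotMr.
rewrite exchange_big; under eq_bigr do rewrite exchange_big.
rewrite exchange_big; apply: eq_bigr => j _; apply: eq_bigr => k _.
by rewrite !mxE qdot_sumr; apply: eq_bigr => i _; rewrite !mxE.
Qed.

Lemma mul_qreal_scalemx m n p (A : 'M[quat R]_(m, n)) (c : R) (B : 'M[quat R]_(n, p)) :
  A *m (qreal c *: B) = qreal c *: (A *m B).
Proof.
apply/matrixP => i j; rewrite !mxE mulr_sumr; apply: eq_bigr => k _.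
by rewrite mxE !mulrA qreal_comm.
Qed.

Section Invertibility.
Variable m : nat.

Definition row_coords (v : 'rV[quat R]_m) : 'M[R]_(4, m) :=
  \matrix_(a, j) tnth [tuple qre (v 0 j); qi (v 0 j); qj (v 0 j); qk (v 0 j)] a.

Definition coords_row (u : 'M[R]_(4, m)) : 'rV[quat R]_m :=
  \row_j Quat (u (inord 0) j) (u (inord 1) j) (u (inord 2) j) (u (inord 3) j).

Lemma ord4P (P : 'I_4 -> Prop) :
  P (inord 0) -> P (inord 1) -> P (inord 2) -> P (inord 3) -> forall a, P a.
Proof.
move=> p0 p1 p2 p3 [[|[|[|[|//]]]] i];
  [move: p0 | move: p1 | move: p2 | move: p3]; congr P; apply: val_inj;
  by rewrite /= inordK.
Qed.

Lemma row_coordsK : cancel row_coords coords_row.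
Proof.
move=> v; apply/rowP => j; rewrite !mxE.
by apply: quatP; rewrite /= !(tnth_nth 0) inordK.
Qed.

Lemma coords_rowK : cancel coords_row row_coords.
Proof.
move=> u; apply/matrixP => a j; elim/ord4P: a;
  by rewrite !mxE (tnth_nth 0) inordK.
Qed.

Lemma coords_row_linear c u v :
  coords_row (c *: u + v) = qreal c *: coords_row u + coords_row v.
Proof. by apply/rowP => j; rewrite !mxE qrealZ. Qed.

Lemma real_coordinates : exists (q : 'M[R]_(4, m) -> 'rV[quat R]_m) u,
  [/\ cancel u q, cancel q u &
      forall (c : R) (v v' : 'M[R]_(4, m)), q (c *: v + v') = qreal c *: q v + q v'].
Proof.
exists coords_row, row_coords; split; [exact: row_coordsK | exact: coords_rowK |].
exact: coords_row_linear.
Qed.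

(** The map [v |-> v S] is a linear endomorphism of the real space of row
    vectors, of dimension [4 m], so injectivity makes it bijective.
    Preimages of the rows of the identity form a left inverse [X], and
    [(S X - 1) S = 0] then shows that [X] is also a right inverse. *)
Lemma injective_invqmx (S : 'M[quat R]_m) :
  (forall v : 'rV_m, v *m S = 0 -> v = 0) ->
  S *m invqmx S = 1%:M /\ invqmx S *m S = 1%:M.
Proof.
move=> Sinj.
suff ex : exists X, S *m X = 1%:M /\ X *m S = 1%:M by exact: (xgetPex 0 ex).
have [q [u [uK qK q_lin]]] := real_coordinates.
have q0 : q 0 = 0.
  by have := q_lin (-1) 0 0; rewrite scaler0 addr0 scalemx_qrealN1 addNr.
pose f t := u (q t *m S).
have f_lin : linear f.
  move=> c v v'; apply: (can_inj qK).
  by rewrite q_lin /f !uK q_lin mulmxDl scalemxAl.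
have [F FE] : {F : {linear 'M[R]_(4, m) -> 'M[R]_(4, m)} | F =1 f}.
  pose F : {linear 'M[R]_(4, m) -> 'M[R]_(4, m)} :=
    HB.pack f (GRing.isLinear.Build R _ _ _ f f_lin).
  by exists F.
have F_unit : lin_mx F \in unitmx.
  rewrite -row_free_unit -kermx_eq0; apply/rowV0P => v /sub_kermxP.
  rewrite -[v]vec_mxK mul_vec_lin => /(canRL mxvecK).
  rewrite linear0 FE => /(congr1 q); rewrite /f uK q0.
  move=> /Sinj; rewrite -q0 => /(can_inj qK) ->.
  by rewrite linear0.
pose g (w : 'rV_m) := q (vec_mx (mxvec (u w) *m invmx (lin_mx F))).
have gS (w : 'rV_m) : g w *m S = w.
  apply: (can_inj uK).
  have -> : u (g w *m S) = F (vec_mx (mxvec (u w) *m invmx (lin_mx F))) by rewrite FE.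
  by apply: (can_inj mxvecK); rewrite -mul_vec_lin vec_mxK mulmxKV.
pose X := \matrix_i g (row i 1%:M).
have XS : X *m S = 1%:M.
  by apply/row_matrixP => i; rewrite row_mul rowK gS.
exists X; split=> //.
apply/eqP; rewrite -subr_eq0; apply/eqP/row_matrixP => i; rewrite row0.
apply: Sinj; rewrite -row_mul mulmxBl -mulmxA XS mulmx1 mul1mx subrr.
by rewrite row0.
Qed.

(** If [v S = 0] then [0 = <v S, v> = |v B|^2 + c |v|^2]. *)
Lemma gram_invqmx k (B : 'M[quat R]_(m, k)) (c : R) : 0 < c ->
  let S := B *m adjq B + (qreal c)%:M in
  S *m invqmx S = 1%:M /\ invqmx S *m S = 1%:M.
Proof.
move=> c0; apply: injective_invqmx => v vS.
have : mdot (v *m (B *m adjq B + (qreal c)%:M)) v = 0 by rewrite vS mdot0l.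
rewrite mulmxDr mulmx_qreal mdotDl mulmxA mdot_mull adjqK mdotZl => h.
apply: mdot_eq0; apply/eqP; rewrite eq_le mdot_ge0 andbT -(pmulr_rle0 _ c0).
by have := mdot_ge0 (v *m B); lra.
Qed.

End Invertibility.
End QuaternionMatrices.

(** * The quaternion Fourier transform *)

Section QuaternionDFT.
Variables (R : realType) (mu : quat R).
Hypothesis mu_unit_pure : unit_pure mu.

(** [exp (- mu a)], which lies in the commutative subfield generated by
    [mu]. *)
Definition qexp (a : R) : quat R := qreal (cos a) - mu * qreal (sin a).

Lemma qexpE a :
  qexp a = Quat (cos a) (- (qi mu * sin a)) (- (qj mu * sin a)) (- (qk mu * sin a)).
Proof.
have [mu0 _] := mu_unit_pure.
rewrite /qexp -qreal_comm; move: mu0; case: mu => m0 m1 m2 m3 /= ->.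
rewrite qrealZ; apply: quatP => /=; ring.
Qed.

Lemma qexpD a b : qexp (a + b) = qexp a * qexp b.
Proof.
have [_] := mu_unit_pure; rewrite !qexpE quatM cosD sinD /normsq => h.
apply: quatP => /=; try ring.
transitivity (cos a * cos b - sin a * sin b *
  (qre mu ^+ 2 + qi mu ^+ 2 + qj mu ^+ 2 + qk mu ^+ 2)); first by rewrite h mulr1.
have [-> _] := mu_unit_pure; ring.
Qed.

Lemma qexp0 : qexp 0 = 1.
Proof. by rewrite qexpE cos0 sin0; apply: quatP; rewrite //= mulr0 oppr0. Qed.

Lemma conjq_qexp a : conjq (qexp a) = qexp (- a).
Proof. by rewrite !qexpE cosN sinN; apply: quatP; rewrite //= mulrN. Qed.

Lemma qexpX a n : qexp a ^+ n = qexp (n%:R * a).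
Proof.
elim: n => [|n IH]; first by rewrite mul0r qexp0.
by rewrite exprS IH -qexpD -natr1; congr qexp; ring.
Qed.

Lemma qexp_2pi n : qexp (2 * pi * n%:R) = 1.
Proof.
rewrite mulrC -qexpX qexpE.
have -> : 2 * pi = pi *+ 2 :> R by rewrite mulr_natl.
rewrite cos2pi sin2pi !mulr0 oppr0.
exact: expr1n.
Qed.

Lemma cos_lt1 (a : R) : 0 < a < 2 * pi -> cos a < 1.
Proof.
move=> /andP[a0 a2].
have s0 : 0 < sin (a / 2) by apply: sin_gt0_pi; rewrite ?divr_gt0//=; lra.
have -> : a = (a / 2) *+ 2 by rewrite -mulr_natr divfK// pnatr_eq0.
rewrite cos_mulr2n -mulr_natr cos2sin2.
by have := exprn_gt0 2 s0; lra.
Qed.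

Lemma qexp_neq1 n (i j : 'I_n) : i != j -> qexp (2 * pi * (i%:R - j%:R) / n%:R) != 1.
Proof.
move=> ij; apply/eqP => /(congr1 (@qre R)); rewrite qexpE /= => c1.
have n0 : 0 < n%:R :> R by rewrite ltr0n (leq_ltn_trans _ (ltn_ord i)).
have pi0 := pi_gt0 R.
wlog ji : i j ij c1 / (j < i)%N => [H|].
  case: (ltngtP i j) => h; [|exact: (H i j)|by case/eqP: ij; apply: val_inj].
  apply: (H j i) => //; first by rewrite eq_sym.
  by rewrite -cosN; apply: etrans c1; congr cos; ring.
have : cos (2 * pi * (i%:R - j%:R) / n%:R : R) < 1.
  apply: cos_lt1; rewrite divr_gt0 ?mulr_gt0 ?subr_gt0 ?ltr_nat//=.
  rewrite ltr_pdivrMr// ltr_pM2l ?mulr_gt0//.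
  have : i%:R < n%:R :> R by rewrite ltr_nat.
  by have := ler0n R j; lra.
by rewrite c1 ltxx.
Qed.

Lemma mulq_eq0 (x y : quat R) : x * y = 0 -> x != 0 -> y = 0.
Proof.
move=> xy x0.
have h : normsq x * normsq y = normsq (x * y) by rewrite quatM /normsq /=; ring.
apply: normsq_eq0; apply/eqP; move: h; rewrite xy /normsq /= !expr0n /= !addr0.
move=> /eqP; rewrite mulf_eq0 => /orP[/eqP hx|//].
by case/eqP: x0; apply: normsq_eq0.
Qed.

(** A geometric sum: its ratio [xi] satisfies [xi ^ n = 1], and when
    [i != j] also [xi != 1], so [(xi - 1) * sum = xi ^ n - 1 = 0] and
    quaternions have no zero divisors. *)
Lemma sum_qexp n (i j : 'I_n) :
  \sum_(p < n) qexp (2 * pi * (p * i)%:R / n%:R) * qexp (- (2 * pi * (p * j)%:R / n%:R))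
  = if i == j then n%:R else 0.
Proof.
have n0 : n%:R != 0 :> R by rewrite pnatr_eq0 -lt0n (leq_ltn_trans _ (ltn_ord i)).
set xi := qexp (2 * pi * (i%:R - j%:R) / n%:R).
under eq_bigr => p _.
  rewrite -qexpD.
  have -> : 2 * pi * (p * i)%:R / n%:R - 2 * pi * (p * j)%:R / n%:R =
     p%:R * (2 * pi * (i%:R - j%:R) / n%:R) :> R by rewrite !natrM; field.
  rewrite -qexpX -/xi; over.
have [ij|ij] := eqVneq i j.
  rewrite /xi ij subrr mulr0 mul0r qexp0.
  by under eq_bigr do rewrite expr1n; rewrite sumr_const card_ord.
have xi1 : xi - 1 != 0 by rewrite subr_eq0 qexp_neq1.
apply: mulq_eq0 xi1; rewrite -subrX1 qexpX.
have -> : n%:R * (2 * pi * (i%:R - j%:R) / n%:R) = 2 * pi * i%:R - 2 * pi * j%:R :> R.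
  by field.
by rewrite qexpD -conjq_qexp !qexp_2pi -qexp0 conjq_qexp oppr0 qexp0 mulr1 subrr.
Qed.

(** The unnormalized transform: the factor sqrt(n3) in the definition of
    [qdft] cancels the factor 1 / sqrt(n3) of [qdft_mx]. *)
Definition dft_mx n : 'M[quat R]_n := \matrix_(p, q) qexp (2 * pi * (p * q)%:R / n%:R).

Lemma dft_mx_adjl n : adjq (dft_mx n) *m dft_mx n = n%:R%:M.
Proof.
apply/matrixP => i j; rewrite !mxE.
transitivity (if j == i then n%:R else 0 : quat R).
  rewrite -sum_qexp; apply: eq_bigr => p _.
  by rewrite !mxE conjq_qexp -!qexpD addrC.
by rewrite eq_sym; case: eqP.
Qed.

Lemma dft_mx_adjr n : dft_mx n *m adjq (dft_mx n) = n%:R%:M.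
Proof.
apply/matrixP => i j; rewrite !mxE.
transitivity (if i == j then n%:R else 0 : quat R).
  rewrite -sum_qexp; apply: eq_bigr => p _.
  by rewrite !mxE conjq_qexp [(p * i)%N]mulnC [(p * j)%N]mulnC.
by case: eqP.
Qed.

Lemma natr_qreal n : n%:R = qreal n%:R :> quat R.
Proof.
elim: n => [//|n IH]; rewrite -!natr1 IH.
by apply: quatP; rewrite //= addr0.
Qed.

Section Tensors.
Variables (n1 n2 n3 : nat).
Hypothesis n3_gt0 : (0 < n3)%N.
Implicit Types X Y : tensor (quat R) n1 n2 n3.

Let n3R : 0 < n3%:R :> R. Proof. by rewrite ltr0n. Qed.

Lemma sum_triple (V : nmodType) (F : 'I_n1 * 'I_n2 * 'I_n3 -> V) :
  \sum_p F p = \sum_i \sum_j \sum_l F (i, j, l).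
Proof.
transitivity (\sum_(ij : 'I_n1 * 'I_n2) \sum_l F (ij, l)).
  by rewrite [RHS]pair_bigA; apply: eq_bigr => -[].
by rewrite [RHS]pair_bigA; apply: eq_bigr => -[].
Qed.

Lemma tnorm_sqr X : tnorm X ^+ 2 = \sum_p normsq (X p).
Proof. by rewrite sqr_sqrtr// sumr_ge0// => p _; exact: normsq_ge0. Qed.

Lemma tnorm_sqr_tube X : tnorm X ^+ 2 = \sum_i \sum_j mdot (tube X i j) (tube X i j).
Proof.
rewrite tnorm_sqr sum_triple; apply: eq_bigr => i _; apply: eq_bigr => j _.
by apply: eq_bigr => l _; rewrite big_ord1 !mxE normsqE.
Qed.

Lemma tnorm_sqr_fslice X : tnorm X ^+ 2 = \sum_l mdot (fslice X l) (fslice X l).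
Proof.
rewrite tnorm_sqr sum_triple; under eq_bigr do rewrite exchange_big.
rewrite exchange_big; apply: eq_bigr => l _; apply: eq_bigr => i _.
by apply: eq_bigr => j _; rewrite !mxE normsqE.
Qed.

Lemma qdftE X i j l : qdft mu X (i, j, l) = (dft_mx n3 *m tube X i j) l 0.
Proof.
rewrite ffunE /= !mxE mulr_sumr; apply: eq_bigr => q _.
rewrite !mxE !mulrA -qrealM divff ?sqrtr_eq0 -?ltNge ?n3R//.
by rewrite -/(qexp _) (_ : qreal 1 = 1)// mul1r.
Qed.

Lemma tube_qdft X i j : tube (qdft mu X) i j = dft_mx n3 *m tube X i j.
Proof. by apply/colP => l; rewrite mxE qdftE. Qed.

Lemma qdft_parseval X :
  tnorm X ^+ 2 = n3%:R^-1 * \sum_l mdot (fslice (qdft mu X) l) (fslice (qdft mu X) l).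
Proof.
rewrite -tnorm_sqr_fslice !tnorm_sqr_tube mulr_sumr; apply: eq_bigr => i _.
rewrite mulr_sumr; apply: eq_bigr => j _.
rewrite tube_qdft mdot_mulr mulmxA dft_mx_adjl natr_qreal mul_scalar_mx mdotZr.
by rewrite mulrA mulVf ?gt_eqF// mul1r.
Qed.

Lemma qdft_surjective Y : exists X, qdft mu X = Y.
Proof.
exists [ffun p => (qreal n3%:R^-1 *: (adjq (dft_mx n3) *m tube Y p.1.1 p.1.2)) p.2 0].
apply/ffunP => -[[i j] l]; rewrite qdftE.
set T := tube _ i j.
have -> : T = qreal n3%:R^-1 *: (adjq (dft_mx n3) *m tube Y i j).
  by apply/colP => q; rewrite mxE ffunE.
rewrite mul_qreal_scalemx mulmxA dft_mx_adjr natr_qreal mul_scalar_mx.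
by rewrite scalemx_qrealA mulVf ?gt_eqF// scale1r mxE.
Qed.

(** The transform is onto, because [dft_mx] is invertible up to the factor
    [n3]; hence [tprod] does satisfy its defining property. *)
Lemma qdft_tprod (r : 'I_n3 -> nat) (A : forall l, 'M[quat R]_(n1, r l))
    (B : forall l, 'M[quat R]_(r l, n2)) l :
  fslice (qdft mu (tprod mu A B)) l = A l *m B l.
Proof.
move: l.
suff ex : exists X, forall l, fslice (qdft mu X) l = A l *m B l by exact: (xgetPex 0 ex).
have [X XE] := qdft_surjective [ffun p => (A p.2 *m B p.2) p.1.1 p.1.2].
by exists X => l; rewrite XE; apply/matrixP => i j; rewrite !mxE ffunE !mxE.
Qed.

Lemma fsliceE X l i j : fslice X l i j = X (i, j, l).
Proof. by rewrite mxE. Qed.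

Lemma mx_addE m n (A B : 'M[quat R]_(m, n)) i j : (A + B) i j = A i j + B i j.
Proof. by rewrite mxE. Qed.

Lemma fslice_qdftD X Y l :
  fslice (qdft mu (X + Y)) l = fslice (qdft mu X) l + fslice (qdft mu Y) l.
Proof.
have slE (Z : tensor (quat R) n1 n2 n3) i j : fslice (qdft mu Z) l i j = (dft_mx n3 *m tube Z i j) l 0.
  by rewrite fsliceE qdftE.
apply/matrixP => i j.
apply: (etrans (slE (X + Y) i j)).
have -> : tube (X + Y) i j = tube X i j + tube Y i j.
  by apply/colP => q; rewrite !mxE ffunE.
rewrite mulmxDr [LHS]mx_addE [RHS]mx_addE.
exact: (esym (congr2 +%R (slE X i j) (slE Y i j))).
Qed.

Lemma fslice_qdftZ c X l :
  fslice (qdft mu [ffun p => qreal c * X p]) l = qreal c *: fslice (qdft mu X) l.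
Proof.
have slE (Z : tensor (quat R) n1 n2 n3) i j : fslice (qdft mu Z) l i j = (dft_mx n3 *m tube Z i j) l 0.
  by rewrite fsliceE qdftE.
set Y := finfun _; apply/matrixP => i j.
apply: (etrans (slE Y i j)).
have -> : tube Y i j = qreal c *: tube X i j by apply/colP => q; rewrite !mxE ffunE.
rewrite mul_qreal_scalemx [LHS]mxE [RHS]mxE.
by congr (_ * _); rewrite slE.
Qed.

End Tensors.
End QuaternionDFT.

(** * Expansion of the objective along one block *)

Section Objective.
Variables (R : realType) (n1 n2 n3 : nat) (r : 'I_n3 -> nat).
Variables (mu : quat R) (lambda lambda1 lambda2 : R).
Hypothesis mu_unit_pure : unit_pure mu.
Hypothesis n3_gt0 : (0 < n3)%N.
Local Notation zvec := (zvec R n1 n2 r).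
Local Notation objective := (@objective R n1 n2 n3 r mu lambda lambda1 lambda2).
Local Notation TV := (@TV R n1 n2 n3 lambda1 lambda2).
Implicit Types (x y d : zvec) (C D : tensor (quat R) n1 n2 n3).

Let n3R : 0 < n3%:R :> R. Proof. by rewrite ltr0n. Qed.

Lemma entryD x y c : entry (x + y) c = entry x c + entry y c.
Proof. by rewrite /entry mxE. Qed.

Lemma entryZ h x c : entry (h *: x) c = h * entry x c.
Proof. by rewrite /entry mxE. Qed.

Lemma zCqE x p : zCq x p = Quat 0 (entry x (inl (inl (inord 0, p))))
  (entry x (inl (inl (inord 1, p)))) (entry x (inl (inl (inord 2, p)))).
Proof. by rewrite !ffunE. Qed.

Lemma zCqD x y : zCq (x + y) = zCq x + zCq y.
Proof.
by apply/ffunP => p; rewrite [RHS]ffunE !zCqE !entryD quatD addr0.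
Qed.

Lemma zCqZ h x : zCq (h *: x) = [ffun p => qreal h * zCq x p].
Proof.
by apply/ffunP => p; rewrite [RHS]ffunE !zCqE !entryZ qrealZ mulr0.
Qed.

Lemma zAE x l i j : zA x l i j =
  let e a := entry x (inl (inr (Tagged (coordA n1 r) (a, (i, j))))) in
  Quat (e (inord 0)) (e (inord 1)) (e (inord 2)) (e (inord 3)).
Proof. by rewrite mxE. Qed.

Lemma zBE x l i j : zB x l i j =
  let e a := entry x (inr (Tagged (coordB n2 r) (a, (i, j)))) in
  Quat (e (inord 0)) (e (inord 1)) (e (inord 2)) (e (inord 3)).
Proof. by rewrite mxE. Qed.

Lemma zAD x y l : zA (x + y) l = zA x l + zA y l.
Proof. by apply/matrixP => i j; rewrite [RHS]mxE !zAE /= !entryD quatD. Qed.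

Lemma zAZ h x l : zA (h *: x) l = qreal h *: zA x l.
Proof. by apply/matrixP => i j; rewrite [RHS]mxE !zAE /= !entryZ qrealZ. Qed.

Lemma zBD x y l : zB (x + y) l = zB x l + zB y l.
Proof. by apply/matrixP => i j; rewrite [RHS]mxE !zBE /= !entryD quatD. Qed.

Lemma zBZ h x l : zB (h *: x) l = qreal h *: zB x l.
Proof. by apply/matrixP => i j; rewrite [RHS]mxE !zBE /= !entryZ qrealZ. Qed.

Definition zChat x l : 'M[quat R]_(n1, n2) := fslice (qdft mu (zCq x)) l.

Lemma zChatD x y l : zChat (x + y) l = zChat x l + zChat y l.
Proof. by rewrite /zChat zCqD; exact: fslice_qdftD. Qed.

Lemma zChatZ h x l : zChat (h *: x) l = qreal h *: zChat x l.
Proof. by rewrite /zChat zCqZ; exact: fslice_qdftZ. Qed.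

(** The polar form of [TV]. *)
Definition TVdot C D : R :=
  lambda1 * \sum_(k < n1) \sum_(k' < n1 | k' == k.+1 :> nat)
    mdot (hslice C k - hslice C k') (hslice D k - hslice D k') +
  lambda2 * \sum_(k < n2) \sum_(k' < n2 | k' == k.+1 :> nat)
    mdot (lslice C k - lslice C k') (lslice D k - lslice D k').

Lemma TV_TVdot C : TV C = TVdot C C.
Proof.
by rewrite /Defs.TV /TVdot; under eq_bigr do under eq_bigr do rewrite fnormq_sqr;
  under [X in _ + _ * X]eq_bigr do under eq_bigr do rewrite fnormq_sqr.
Qed.

Lemma TVdotC C D : TVdot C D = TVdot D C.
Proof.
by congr (_ * _ + _ * _); apply: eq_bigr => k _; apply: eq_bigr => k' _; rewrite mdotC.
Qed.

Lemma TVdotDr C D D' : TVdot C (D + D') = TVdot C D + TVdot C D'.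
Proof.
rewrite /TVdot addrACA -!mulrDr -!big_split /=.
congr (_ * _ + _ * _); apply: eq_bigr => k _; rewrite -big_split /=;
  apply: eq_bigr => k' _; rewrite -mdotDr; congr mdot;
  by apply/matrixP => i j; rewrite !mxE !ffunE opprD addrACA.
Qed.

Lemma TVdotZr C h D : TVdot C [ffun p => qreal h * D p] = h * TVdot C D.
Proof.
rewrite /TVdot mulrDr !mulrA ![h * lambda1]mulrC ![h * lambda2]mulrC -!mulrA !mulr_sumr.
congr (_ + _); apply: eq_bigr => k _; rewrite !mulr_sumr;
  apply: eq_bigr => k' _; rewrite -mdotZr; congr (_ * mdot _ _);
  by apply/matrixP => i j; rewrite !mxE !ffunE mulrBr.
Qed.

Lemma TV_sqrD C D : TV (C + D) = TV C + 2 * TVdot C D + TV D.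
Proof.
rewrite !TV_TVdot TVdotDr !(TVdotC (C + D)) !TVdotDr.
by rewrite (TVdotC D C) mulr_natl mulr2n !addrA.
Qed.

Lemma TV_ge0 C : 0 <= lambda1 -> 0 <= lambda2 -> 0 <= TV C.
Proof.
move=> l1 l2; rewrite /Defs.TV addr_ge0 ?mulr_ge0//;
  by apply: sumr_ge0 => k _; apply: sumr_ge0 => k' _; rewrite sqr_ge0.
Qed.

Definition residual x l := zA x l *m zB x l - zChat x l.

(** The derivative of [residual] at [x] in the direction [d]. *)
Definition dresidual x d l := zA x l *m zB d l + zA d l *m zB x l - zChat d l.

(** The derivative of the objective at [x] in the direction [d], written on
    the Fourier side. *)
Definition gradient_form x d : R :=
  n3%:R^-1 * \sum_l mdot (residual x l) (dresidual x d l)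
  + lambda / n3%:R * (\sum_l mdot (zA x l) (zA d l) + \sum_l mdot (zB x l) (zB d l))
  + 2 * TVdot (zCq x) (zCq d).

Definition quadratic_form x d : R :=
  (2 * n3%:R)^-1 * \sum_l mdot (dresidual x d l) (dresidual x d l)
  + lambda / (2 * n3%:R) *
     (\sum_l mdot (zA d l) (zA d l) + \sum_l mdot (zB d l) (zB d l))
  + TV (zCq d).

(** By Parseval, the fidelity term can be measured slice by slice in the
    Fourier domain, where [tprod] is the product of matrices. *)
Lemma objectiveE x : objective x =
  (2 * n3%:R)^-1 * \sum_l mdot (residual x l) (residual x l)
  + lambda / (2 * n3%:R) *
     (\sum_l mdot (zA x l) (zA x l) + \sum_l mdot (zB x l) (zB x l))
  + TV (zCq x).
Proof.
rewrite /Defs.objective; congr (_ + _ * _ + _); last first.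
  by congr (_ + _); apply: eq_bigr => l _; rewrite fnormq_sqr.
rewrite (qdft_parseval mu_unit_pure n3_gt0) mulrA invfM; congr (_ * _).
apply: eq_bigr => l _.
suff -> : fslice (qdft mu (tprod mu (zA x) (zB x) - zCq x)) l = residual x l by [].
have -> : - zCq x = [ffun p => qreal (-1) * zCq x p].
  by apply/ffunP => p; rewrite !ffunE qrealZ; apply: quatP; rewrite /= mulN1r.
rewrite [LHS]fslice_qdftD// [X in _ + X]fslice_qdftZ// scalemx_qrealN1.
by congr (_ - _); exact: qdft_tprod.
Qed.

Lemma mdot_sqrD m n (U V : 'M[quat R]_(m, n)) :
  mdot (U + V) (U + V) = mdot U U + 2 * mdot U V + mdot V V.
Proof. by rewrite mdotDr !mdotDl (mdotC V U); ring. Qed.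

(** The residual is bilinear in the blocks A and B; when the product of the
    A- and B-parts of [d] vanishes it is affine along [d], and the objective
    is exactly quadratic.  This covers directions in a single block. *)
Lemma objective_expansion x d : (forall l, zA d l *m zB d l = 0) ->
  objective (x + d) = objective x + gradient_form x d + quadratic_form x d.
Proof.
move=> AB0.
have expand k (A A' : 'M[quat R]_(n1, k)) (B B' : 'M[quat R]_(k, n2)) E E' :
    A' *m B' = 0 ->
    (A + A') *m (B + B') - (E + E') = (A *m B - E) + (A *m B' + A' *m B - E').
  move=> AB'; rewrite mulmxDl !mulmxDr AB' addr0 opprD.
  by rewrite -(addrA (A *m B)) addrACA.
have resD l : residual (x + d) l = residual x l + dresidual x d l.
  apply: etrans (expand _ _ _ _ _ _ _ (AB0 l)).
  exact: (congr2 (fun a b => a - b) (congr2 mulmx (zAD _ _ _) (zBD _ _ _)) (zChatD _ _ _)).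
have sum_sqrD (m n : 'I_n3 -> nat) (U V W : forall l, 'M[quat R]_(m l, n l)) :
    (forall l, W l = U l + V l) ->
    \sum_l mdot (W l) (W l) =
    \sum_l mdot (U l) (U l) + 2 * (\sum_l mdot (U l) (V l)) + \sum_l mdot (V l) (V l).
  move=> WE; rewrite mulr_sumr -!big_split /=; apply: eq_bigr => l _.
  by rewrite WE mdot_sqrD.
have collect (n r0 r1 r2 a0 a1 a2 b0 b1 b2 t0 t1 t2 : R) : n != 0 ->
    (2 * n)^-1 * (r0 + 2 * r1 + r2)
    + lambda / (2 * n) * ((a0 + 2 * a1 + a2) + (b0 + 2 * b1 + b2))
    + (t0 + 2 * t1 + t2) =
    ((2 * n)^-1 * r0 + lambda / (2 * n) * (a0 + b0) + t0)
    + (n^-1 * r1 + lambda / n * (a1 + b1) + 2 * t1)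
    + ((2 * n)^-1 * r2 + lambda / (2 * n) * (a2 + b2) + t2).
  by move=> ?; field.
apply: (etrans (objectiveE (x + d))); rewrite [objective x]objectiveE.
apply: etrans (collect _ _ _ _ _ _ _ _ _ _ _ _ _ _); last by rewrite gt_eqF.
congr (_ * _ + _ * (_ + _) + _).
- apply: (sum_sqrD (fun=> n1) (fun=> n2)) => l; exact: resD.
- apply: (sum_sqrD (fun=> n1) r) => l; exact: zAD.
- apply: (sum_sqrD r (fun=> n2)) => l; exact: zBD.
- by rewrite zCqD TV_sqrD.
Qed.

Lemma dresidualZ x h d l : dresidual x (h *: d) l = qreal h *: dresidual x d l.
Proof.
rewrite /dresidual scalerBr scalerDr -(mul_qreal_scalemx _ _ (zB d l)) (scalemxAl _ (zA d l)).
exact: (congr2 (fun a b => a - b)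
  (congr2 +%R (congr1 _ (zBZ _ _ _)) (congr1 (mulmx^~ _) (zAZ _ _ _))) (zChatZ _ _ _)).
Qed.

Lemma gradient_formZ x h d : gradient_form x (h *: d) = h * gradient_form x d.
Proof.
have sumZ (m n : 'I_n3 -> nat) (U V W : forall l, 'M[quat R]_(m l, n l)) :
    (forall l, W l = qreal h *: V l) ->
    \sum_l mdot (U l) (W l) = h * \sum_l mdot (U l) (V l).
  by move=> WV; rewrite mulr_sumr; apply: eq_bigr => l _; rewrite WV mdotZr.
have collect (a b u1 u2 u3 u4 : R) :
    a * (h * u1) + b * (h * u2 + h * u3) + 2 * (h * u4) =
    h * (a * u1 + b * (u2 + u3) + 2 * u4) by ring.
apply: etrans (collect _ _ _ _ _ _); congr (_ * _ + _ * (_ + _) + 2 * _).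
- apply: (sumZ (fun=> n1) (fun=> n2)) => l; exact: dresidualZ.
- apply: (sumZ (fun=> n1) r) => l; exact: zAZ.
- apply: (sumZ r (fun=> n2)) => l; exact: zBZ.
- by rewrite zCqZ TVdotZr.
Qed.

Lemma quadratic_formZ x h d : quadratic_form x (h *: d) = h ^+ 2 * quadratic_form x d.
Proof.
have sumZ (m n : 'I_n3 -> nat) (V W : forall l, 'M[quat R]_(m l, n l)) :
    (forall l, W l = qreal h *: V l) ->
    \sum_l mdot (W l) (W l) = h ^+ 2 * \sum_l mdot (V l) (V l).
  by move=> WV; rewrite mulr_sumr; apply: eq_bigr => l _; rewrite WV mdotZr mdotZl mulrA.
have collect (a b u1 u2 u3 u4 : R) :
    a * (h ^+ 2 * u1) + b * (h ^+ 2 * u2 + h ^+ 2 * u3) + h ^+ 2 * u4 =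
    h ^+ 2 * (a * u1 + b * (u2 + u3) + u4) by ring.
apply: etrans (collect _ _ _ _ _ _); congr (_ * _ + _ * (_ + _) + _).
- apply: (sumZ (fun=> n1) (fun=> n2)) => l; exact: dresidualZ.
- apply: (sumZ (fun=> n1) r) => l; exact: zAZ.
- apply: (sumZ r (fun=> n2)) => l; exact: zBZ.
- by rewrite zCqZ !TV_TVdot TVdotZr TVdotC TVdotZr mulrA.
Qed.

Lemma derive_objective x d : (forall l, zA d l *m zB d l = 0) ->
  'D_d objective x = gradient_form x d.
Proof.
move=> AB0; apply/cvg_lim => //.
have lin : (fun h => gradient_form x d + h * quadratic_form x d) h @[h --> 0^'] -->
    gradient_form x d.
  rewrite -[X in _ --> X]addr0 -[X in _ --> _ + X](mul0r (quadratic_form x d)).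
  apply: cvgD; first exact: cvg_cst.
  apply: cvgMl; apply: cvg_within_filter; exact: cvg_id.
apply: cvg_trans lin; apply: near_eq_cvg.
near=> h.
have h0 : h != 0 by near: h; exact: nbhs_dnbhs_neq.
rewrite /= (addrC (h *: d)) objective_expansion => [|l]; last first.
  by rewrite zAZ zBZ mul_qreal_scalemx -scalemxAl AB0 !scaler0.
rewrite gradient_formZ quadratic_formZ /GRing.scale /=.
by field.
Unshelve. all: by end_near.
Qed.

End Objective.

(** * Locally Lipschitz functions *)

Section LocallyLipschitz.
Variables (R : realType) (V : normedModType R).

(** Lipschitz on every ball.  This class is closed under sums and products, so
    it contains every function that is polynomial in the coordinates, among
    them the objective and each of its directional derivatives. *)
Definition loclip (g : V -> R) := forall M : R, exists2 K : R, 0 <= K &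
  forall x y, `|x| <= M -> `|y| <= M -> `|g x - g y| <= K * `|x - y|.

Lemma loclip_bounded g : loclip g -> forall M : R, exists2 B : R, 0 <= B &
  forall x, `|x| <= M -> `|g x| <= B.
Proof.
move=> lg M; have [K K0 HK] := lg M.
exists (`|g 0| + K * `|M|); first by rewrite addr_ge0 ?mulr_ge0.
move=> x xM; have := HK x 0 xM; rewrite normr0 subr0 => /(_ (le_trans (normr_ge0 _) xM)).
have := ler_normD (g x - g 0) (g 0); rewrite subrK.
have : K * `|x| <= K * `|M| by rewrite ler_wpM2l// (le_trans xM) ?ler_norm.
lra.
Qed.

Lemma loclip_cst (c : R) : loclip (fun=> c).
Proof. by move=> M; exists 0 => // x y _ _; rewrite subrr normr0 mul0r. Qed.

Lemma loclipD f g : loclip f -> loclip g -> loclip (fun x => f x + g x).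
Proof.
move=> lf lg M; have [K K0 HK] := lf M; have [L L0 HL] := lg M.
exists (K + L); first exact: addr_ge0.
move=> x y xM yM; rewrite opprD addrACA mulrDl (le_trans (ler_normD _ _))//.
by rewrite lerD ?HK ?HL.
Qed.

Lemma loclipN f : loclip f -> loclip (fun x => - f x).
Proof.
move=> lf M; have [K K0 HK] := lf M; exists K => // x y xM yM.
by rewrite -opprD normrN HK.
Qed.

Lemma loclipB f g : loclip f -> loclip g -> loclip (fun x => f x - g x).
Proof. by move=> lf lg; apply: loclipD => //; exact: loclipN. Qed.

Lemma loclipM f g : loclip f -> loclip g -> loclip (fun x => f x * g x).
Proof.
move=> lf lg M; have [K K0 HK] := lf M; have [L L0 HL] := lg M.
have [A A0 HA] := loclip_bounded lf M; have [B B0 HB] := loclip_bounded lg M.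
exists (K * B + A * L); first by rewrite addr_ge0 ?mulr_ge0.
move=> x y xM yM.
have -> : f x * g x - f y * g y = (f x - f y) * g x + f y * (g x - g y) by ring.
apply: (le_trans (ler_normD _ _)); rewrite !normrM mulrDl; apply: lerD.
  by rewrite mulrAC; apply: ler_pM => //; [exact: HK | exact: HB].
by rewrite -mulrA; apply: ler_pM => //; [exact: HA | exact: HL].
Qed.

Lemma loclip_sum (I : finType) (P : pred I) (F : I -> V -> R) :
  (forall i, loclip (F i)) -> loclip (fun x => \sum_(i | P i) F i x).
Proof.
move=> lF; elim: (index_enum I) => [|i s IH].
  by under eq_fun do rewrite big_nil; exact: loclip_cst.
under eq_fun do rewrite big_cons.
by case: (P i) => //; apply: loclipD.
Qed.

Lemma loclip_cvg g (u : nat -> V) a : loclip g -> u @ \oo --> a ->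
  (fun n => g (u n)) @ \oo --> g a.
Proof.
move=> lg ua.
have [M [M0 HM]] : bounded_fun u by apply: cvg_seq_bounded; apply/cvg_ex; exists a.
pose M1 := Num.max (M + 1) `|a|.
have [K K0 HK] := lg M1.
apply/cvgrPdist_le => e e0.
have d0 : 0 < e / (K + 1) by rewrite divr_gt0// ltr_wpDl.
move/cvgrPdist_le : ua => /(_ _ d0); apply: filterS => n an.
apply: (@le_trans _ _ (K * `|a - u n|)).
  apply: HK; first by rewrite le_max lexx orbT.
  by rewrite le_max HM ?ltrDl.
apply: (@le_trans _ _ ((K + 1) * `|a - u n|)); first by rewrite ler_wpM2r// lerDl.
by rewrite mulrC -ler_pdivlMr// ltr_wpDl.
Qed.

Definition qloclip (g : V -> quat R) :=
  [/\ loclip (fun x => qre (g x)), loclip (fun x => qi (g x)),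
      loclip (fun x => qj (g x)) & loclip (fun x => qk (g x))].

Lemma qloclip_cst c : qloclip (fun=> c).
Proof. by split; exact: loclip_cst. Qed.

Lemma qloclipD f g : qloclip f -> qloclip g -> qloclip (fun x => f x + g x).
Proof.
move=> [f0 f1 f2 f3] [g0 g1 g2 g3].
by split; [exact: (loclipD f0 g0) | exact: (loclipD f1 g1) | exact: (loclipD f2 g2)
  | exact: (loclipD f3 g3)].
Qed.

Lemma qloclipN f : qloclip f -> qloclip (fun x => - f x).
Proof.
move=> [f0 f1 f2 f3].
by split; [exact: (loclipN f0) | exact: (loclipN f1) | exact: (loclipN f2)
  | exact: (loclipN f3)].
Qed.

Lemma qloclipM f g : qloclip f -> qloclip g -> qloclip (fun x => f x * g x).
Proof.
move=> [f0 f1 f2 f3] [g0 g1 g2 g3].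
have M := @loclipM; split.
- exact: (loclipB (loclipB (loclipB (M _ _ f0 g0) (M _ _ f1 g1)) (M _ _ f2 g2)) (M _ _ f3 g3)).
- exact: (loclipB (loclipD (loclipD (M _ _ f0 g1) (M _ _ f1 g0)) (M _ _ f2 g3)) (M _ _ f3 g2)).
- exact: (loclipD (loclipD (loclipB (M _ _ f0 g2) (M _ _ f1 g3)) (M _ _ f2 g0)) (M _ _ f3 g1)).
- exact: (loclipD (loclipB (loclipD (M _ _ f0 g3) (M _ _ f1 g2)) (M _ _ f2 g1)) (M _ _ f3 g0)).
Qed.

Lemma qloclip_sum (I : finType) (F : I -> V -> quat R) :
  (forall i, qloclip (F i)) -> qloclip (fun x => \sum_i F i x).
Proof.
move=> lF; elim: (index_enum I) => [|i s IH].
  by under eq_fun do rewrite big_nil; exact: qloclip_cst.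
by under eq_fun do rewrite big_cons; exact: qloclipD.
Qed.

Lemma loclip_qdot f g : qloclip f -> qloclip g -> loclip (fun x => qdot (f x) (g x)).
Proof.
move=> [????] [????]; apply: loclipD; [apply: loclipD; [apply: loclipD|]|]; exact: loclipM.
Qed.

Section Matrices.
Variables m n : nat.

Definition mloclip (g : V -> 'M[quat R]_(m, n)) := forall i j, qloclip (fun x => g x i j).

Lemma mloclip_cst c : mloclip (fun=> c).
Proof. by move=> i j; exact: qloclip_cst. Qed.

Lemma mloclipD f g : mloclip f -> mloclip g -> mloclip (fun x => f x + g x).
Proof. by move=> lf lg i j; under eq_fun do rewrite mxE; exact: qloclipD. Qed.

Lemma mloclipB f g : mloclip f -> mloclip g -> mloclip (fun x => f x - g x).
Proof.
by move=> lf lg i j; under eq_fun do rewrite !mxE; apply: qloclipD => //; exact: qloclipN.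
Qed.

Lemma loclip_mdot f g : mloclip f -> mloclip g -> loclip (fun x => mdot (f x) (g x)).
Proof.
by move=> lf lg; apply: loclip_sum => i; apply: loclip_sum => j; exact: loclip_qdot.
Qed.

End Matrices.

Lemma mloclipM m n p (f : V -> 'M[quat R]_(m, n)) (g : V -> 'M[quat R]_(n, p)) :
  mloclip f -> mloclip g -> mloclip (fun x => f x *m g x).
Proof.
move=> lf lg i j; under eq_fun do rewrite mxE.
by apply: qloclip_sum => k; exact: qloclipM.
Qed.

End LocallyLipschitz.

Section ObjectiveLipschitz.
Variables (R : realType) (n1 n2 n3 : nat) (r : 'I_n3 -> nat).
Variables (mu : quat R) (lambda lambda1 lambda2 : R).
Hypothesis mu_unit_pure : unit_pure mu.
Hypothesis n3_gt0 : (0 < n3)%N.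
Local Notation zvec := (zvec R n1 n2 r).
Implicit Types (x y d : zvec).

Lemma entry_le_norm x c : `|entry x c| <= `|x|.
Proof.
rewrite /entry; set j := enum_rank c.
have -> : `|x| = \big[Num.max/0]_ij `|x ij.1 ij.2| by exact: mx_normrE.
by rewrite (bigmaxD1 (0, j))//= le_max lexx.
Qed.

Lemma norm_le_entry x (B : R) : 0 <= B -> (forall c, `|entry x c| <= B) -> `|x| <= B.
Proof.
move=> B0 xB.
have -> : `|x| = \big[Num.max/0]_ij `|x ij.1 ij.2| by exact: mx_normrE.
apply/bigmax_leP; split => // -[i j] _ /=.
by rewrite (ord1 i) -(enum_valK j); exact: xB.
Qed.

Lemma loclip_entry c : loclip (fun x : zvec => entry x c).
Proof.
move=> M; exists 1 => // x y _ _; rewrite mul1r.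
by have := entry_le_norm (x - y) c; rewrite {1}/entry !mxE.
Qed.

(** Together with the two next lemmas, the base case: the blocks are made of
    coordinates of [x]. *)
Lemma qloclip_zCq p : qloclip (fun x : zvec => zCq x p).
Proof.
under eq_fun do rewrite zCqE.
by split; [exact: loclip_cst | exact: loclip_entry ..].
Qed.

Lemma mloclip_zA l : mloclip (fun x : zvec => zA x l).
Proof. by move=> i j; under eq_fun do rewrite zAE; split; exact: loclip_entry. Qed.

Lemma mloclip_zB l : mloclip (fun x : zvec => zB x l).
Proof. by move=> i j; under eq_fun do rewrite zBE; split; exact: loclip_entry. Qed.

Lemma mloclip_zChat l : mloclip (fun x : zvec => zChat mu x l).
Proof.
move=> i j.
have E (x : zvec) : zChat mu x l i j = \sum_q dft_mx mu n3 l q * zCq x (i, j, q).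
  rewrite mxE qdftE// mxE; apply: eq_bigr => q _; congr (_ * _); exact: mxE.
under eq_fun do rewrite E.
apply: qloclip_sum => q; apply: qloclipM; first exact: qloclip_cst.
exact: qloclip_zCq.
Qed.

Lemma mloclip_residual l : mloclip (fun x : zvec => residual mu x l).
Proof.
apply: mloclipB; last exact: mloclip_zChat.
by apply: mloclipM; [exact: mloclip_zA | exact: mloclip_zB].
Qed.

Lemma mloclip_dresidual d l : mloclip (fun x : zvec => dresidual mu x d l).
Proof.
apply: mloclipB; last exact: mloclip_cst.
apply: mloclipD; apply: mloclipM; first [exact: mloclip_cst | exact: mloclip_zA | exact: mloclip_zB].
Qed.

Lemma loclip_TVdot (C D : zvec -> tensor (quat R) n1 n2 n3) :
  (forall p, qloclip (fun x => C x p)) -> (forall p, qloclip (fun x => D x p)) ->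
  loclip (fun x => TVdot lambda1 lambda2 (C x) (D x)).
Proof.
move=> lC lD; have slice (E : zvec -> tensor (quat R) n1 n2 n3) :
    (forall p, qloclip (fun x => E x p)) ->
    (forall k, mloclip (fun x => hslice (E x) k)) /\
    (forall k, mloclip (fun x => lslice (E x) k)).
  by move=> lE; split => k i j; under eq_fun do rewrite mxE.
have [hC sC] := slice _ lC; have [hD sD] := slice _ lD.
apply: loclipD; apply: loclipM; try exact: loclip_cst.
  by apply: loclip_sum => k; apply: loclip_sum => k'; apply: loclip_mdot; exact: mloclipB.
by apply: loclip_sum => k; apply: loclip_sum => k'; apply: loclip_mdot; exact: mloclipB.
Qed.

Lemma loclip_gradient_form d :
  loclip (fun x : zvec => gradient_form mu lambda lambda1 lambda2 x d).
Proof.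
apply: loclipD; first apply: loclipD.
- apply: loclipM; first exact: loclip_cst.
  apply: loclip_sum => l; apply: loclip_mdot; first exact: mloclip_residual.
  exact: mloclip_dresidual.
- apply: loclipM; first exact: loclip_cst.
  apply: loclipD; apply: loclip_sum => l; apply: loclip_mdot; try exact: mloclip_cst.
    exact: mloclip_zA.
  exact: mloclip_zB.
- apply: loclipM; first exact: loclip_cst.
  apply: loclip_TVdot => p; last exact: qloclip_cst.
  exact: qloclip_zCq.
Qed.

Lemma loclip_objective : loclip (@objective R n1 n2 n3 r mu lambda lambda1 lambda2).
Proof.
have -> : @objective R n1 n2 n3 r mu lambda lambda1 lambda2 = (fun x : zvec =>
  (2 * n3%:R)^-1 * \sum_l mdot (residual mu x l) (residual mu x l)
  + lambda / (2 * n3%:R) *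
     (\sum_l mdot (zA x l) (zA x l) + \sum_l mdot (zB x l) (zB x l))
  + TVdot lambda1 lambda2 (zCq x) (zCq x)).
  by apply/funext => x; rewrite objectiveE// TV_TVdot.
apply: loclipD; first apply: loclipD.
- apply: loclipM; first exact: loclip_cst.
  by apply: loclip_sum => l; apply: loclip_mdot; exact: mloclip_residual.
- apply: loclipM; first exact: loclip_cst.
  apply: loclipD; apply: loclip_sum => l; apply: loclip_mdot;
    first [exact: mloclip_zA | exact: mloclip_zB].
- by apply: loclip_TVdot => p; exact: qloclip_zCq.
Qed.

End ObjectiveLipschitz.

(** * One step of the algorithm *)

(** The common algebra of the A- and B-steps: the regularized normal equation,
    with the proximal term moved to the right-hand side. *)
Lemma ridge_residual (R : realType) m n (lambda beta : R) (U V A A' : 'M[quat R]_(m, n)) :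
  U + qreal (lambda + beta) *: A' = V + qreal beta *: A ->
  U - V + qreal lambda *: A' = qreal (- beta) *: (A' - A).
Proof.
move=> e; apply/matrixP => i j; move/matrixP: e => /(_ i j); rewrite !mxE.
move: (U i j) (V i j) (A i j) (A' i j) => [????] [????] [????] [????].
rewrite !qrealZ !quatD => -[????].
apply: quatP; rewrite ?quatM /=; lra.
Qed.

Lemma ord3P (P : 'I_3 -> Prop) :
  P (inord 0) -> P (inord 1) -> P (inord 2) -> forall a, P a.
Proof.
move=> p0 p1 p2 [[|[|[|//]]] i]; [move: p0 | move: p1 | move: p2];
  congr P; apply: val_inj; by rewrite /= inordK.
Qed.

Section Step.
Variables (R : realType) (n1 n2 n3 : nat) (r : 'I_n3 -> nat).
Variables (mu : quat R) (M : tensor (quat R) n1 n2 n3).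
Variable Omega : {set 'I_n1 * 'I_n2 * 'I_n3}.
Variables (lambda lambda1 lambda2 beta : R).
Hypothesis mu_unit_pure : unit_pure mu.
Hypothesis n3_gt0 : (0 < n3)%N.
Hypotheses (lambda_gt0 : 0 < lambda) (lambda1_gt0 : 0 < lambda1).
Hypotheses (lambda2_gt0 : 0 < lambda2) (beta_gt0 : 0 < beta).
Local Notation zvec := (zvec R n1 n2 r).
Local Notation f := (@objective R n1 n2 n3 r mu lambda lambda1 lambda2).
Local Notation G := (@gradient_form R n1 n2 n3 r mu lambda lambda1 lambda2).
Local Notation Q := (@quadratic_form R n1 n2 n3 r mu lambda lambda1 lambda2).
Implicit Types (x y w d z : zvec) (X Y delta : tensor (quat R) n1 n2 n3).

Let n3R : 0 < n3%:R :> R. Proof. by rewrite ltr0n. Qed.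

Lemma entry_inj x y : (forall c, entry x c = entry y c) -> x = y.
Proof. by move=> xy; apply/rowP => j; rewrite -(enum_valK j); exact: xy. Qed.

(** The vector with the C-block of [x], the A-block of [y] and the B-block of
    [w]: the points visited between [z] and [z'] are [splice z' z z] after the
    C-step and [splice z' z' z] after the A-step. *)
Definition splice x y w : zvec := \row_c match enum_val c with
  | inl (inl _) => x 0 c
  | inl (inr _) => y 0 c
  | inr _ => w 0 c
  end.

Lemma entry_splice x y w c : entry (splice x y w) c = match c with
  | inl (inl _) => entry x c
  | inl (inr _) => entry y c
  | inr _ => entry w c
  end.
Proof. by rewrite /entry mxE enum_rankK; case: c => [[]|]. Qed.

Lemma splice_id x : splice x x x = x.
Proof. by apply: entry_inj => c; rewrite entry_splice; case: c => [[]|]. Qed.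

Lemma spliceD x y w x' y' w' :
  splice x y w + splice x' y' w' = splice (x + x') (y + y') (w + w').
Proof. by apply: entry_inj => c; rewrite entryD !entry_splice; case: c => [[]|] ?; rewrite entryD. Qed.

Lemma spliceZ h x y w : h *: splice x y w = splice (h *: x) (h *: y) (h *: w).
Proof. by apply: entry_inj => c; rewrite entryZ !entry_splice; case: c => [[]|] ?; rewrite entryZ. Qed.

Lemma norm_splice_le x y w (B : R) : `|x| <= B -> `|y| <= B -> `|w| <= B -> `|splice x y w| <= B.
Proof.
move=> xB yB wB; apply: norm_le_entry => [|c]; first exact: le_trans xB.
rewrite entry_splice; case: c => [[c|c]|c];
  by [apply: le_trans xB; exact: entry_le_norm | apply: le_trans yB; exact: entry_le_norm
     | apply: le_trans wB; exact: entry_le_norm].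
Qed.

Lemma zCq_splice x y w : zCq (splice x y w) = zCq x.
Proof. by apply/ffunP => p; rewrite !zCqE !entry_splice. Qed.

Lemma zA_splice x y w : zA (splice x y w) = zA y.
Proof. by apply: functional_extensionality_dep => l; apply/matrixP => i j; rewrite !zAE /= !entry_splice. Qed.

Lemma zB_splice x y w : zB (splice x y w) = zB w.
Proof. by apply: functional_extensionality_dep => l; apply/matrixP => i j; rewrite !zBE /= !entry_splice. Qed.

Lemma zChat_splice x y w l : zChat mu (splice x y w) l = zChat mu x l.
Proof. by rewrite /zChat zCq_splice. Qed.

Lemma entry0 c : entry (0 : zvec) c = 0.
Proof. by rewrite /entry mxE. Qed.

Lemma zA0 l : zA (0 : zvec) l = 0.
Proof. by apply/matrixP => i j; rewrite zAE /= !entry0 mxE. Qed.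

Lemma zB0 l : zB (0 : zvec) l = 0.
Proof. by apply/matrixP => i j; rewrite zBE /= !entry0 mxE. Qed.

Lemma zChat0 l : zChat mu (0 : zvec) l = 0.
Proof.
have := zChatZ mu n3_gt0 0 (0 : zvec) l; rewrite scale0r => ->.
by rewrite (_ : qreal 0 = 0)// scale0r.
Qed.

Lemma TVdot0r C : TVdot lambda1 lambda2 C (zCq (0 : zvec)) = 0.
Proof. by rewrite -[X in zCq X](scale0r 0) zCqZ TVdotZr mul0r. Qed.

Lemma zAB x y l : zA (x - y) l = zA x l - zA y l.
Proof. by rewrite zAD -scaleN1r zAZ scalemx_qrealN1. Qed.

Lemma zBB x y l : zB (x - y) l = zB x l - zB y l.
Proof. by rewrite zBD -scaleN1r zBZ scalemx_qrealN1. Qed.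

Definition cdot X Y : R := \sum_p qdot (X p) (Y p).

Lemma cdotDr X Y Y' : cdot X (Y + Y') = cdot X Y + cdot X Y'.
Proof. by rewrite -big_split; apply: eq_bigr => p _; rewrite ffunE qdotDr. Qed.

Lemma cdotZr X h Y : cdot X [ffun p => qreal h * Y p] = h * cdot X Y.
Proof. by rewrite mulr_sumr; apply: eq_bigr => p _; rewrite ffunE qdotZr. Qed.

Lemma tdot_cdot delta x :
  \sum_(a < 3) tdot (tmap (qimag a) delta) (tmap (qimag a) (zCq x)) = cdot delta (zCq x).
Proof.
rewrite !big_ord_recl big_ord0 addr0 /tdot -!big_split /=.
apply: eq_bigr => p _; rewrite !ffunE /qimag !(tnth_nth (@qi R)) /= /qdot /= mulr0 add0r.
by rewrite addrA.
Qed.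


Lemma quadratic_form_ge0 x d : 0 <= Q x d.
Proof.
have sum_ge0 (m n : 'I_n3 -> nat) (U : forall l, 'M[quat R]_(m l, n l)) :
  0 <= \sum_l mdot (U l) (U l) by apply: sumr_ge0 => l _; exact: mdot_ge0.
apply: addr_ge0; last exact: TV_ge0 (ltW lambda1_gt0) (ltW lambda2_gt0).
apply: addr_ge0; apply: mulr_ge0.
- by rewrite invr_ge0 mulr_ge0.
- exact: (sum_ge0 (fun=> n1) (fun=> n2)).
- by rewrite divr_ge0 ?(ltW lambda_gt0)// mulr_ge0.
- apply: addr_ge0; first exact: (sum_ge0 (fun=> n1) r).
  exact: (sum_ge0 r (fun=> n2)).
Qed.

(** In the C-block the residual moves by [- zChat d], whose norm is given back
    by Parseval. *)
Lemma quadratic_form_C x d : 2^-1 * tnorm (zCq d) ^+ 2 <= Q x (splice d 0 0).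
Proof.
have dres l : dresidual mu x (splice d 0 0) l = - zChat mu d l.
  by rewrite /dresidual zA_splice zB_splice zA0 zB0 mulmx0 mul0mx addr0 sub0r zChat_splice.
rewrite (qdft_parseval mu_unit_pure n3_gt0) mulrA -invfM /quadratic_form -addrA.
have -> : \sum_l mdot (dresidual mu x (splice d 0 0) l) (dresidual mu x (splice d 0 0) l)
    = \sum_l mdot (zChat mu d l) (zChat mu d l).
  by apply: eq_bigr => l _; rewrite (dres l) mdotNr mdotNl opprK.
rewrite lerDl zCq_splice zA_splice zB_splice.
apply: addr_ge0; last exact: TV_ge0 (ltW lambda1_gt0) (ltW lambda2_gt0).
have -> : \sum_l mdot (zA (0 : zvec) l) (zA (0 : zvec) l) = 0.
  by apply: big1 => l _; rewrite zA0 mdot0r.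
have -> : \sum_l mdot (zB (0 : zvec) l) (zB (0 : zvec) l) = 0.
  by apply: big1 => l _; rewrite zB0 mdot0r.
by rewrite addr0 mulr0.
Qed.

(** Up to a constant, the C-step minimizes the objective, tilted by [delta],
    over the C-block. *)
Lemma C_objectiveE z delta y :
  C_objective mu lambda1 lambda2 z delta (zCq y) =
  f (splice y z z) - lambda / (2 * n3%:R) *
    (\sum_l fnormq (zA z l) ^+ 2 + \sum_l fnormq (zB z l) ^+ 2) + cdot delta (zCq y).
Proof.
rewrite /C_objective /objective zCq_splice zA_splice zB_splice tdot_cdot.
by congr (_ + _); rewrite addrAC addrK.
Qed.

Lemma linear_coef_eq0 (a b : R) : (forall h, 0 <= h * a + h ^+ 2 * b) -> a = 0.
Proof.
move=> ab; apply/eqP; apply: contraT => a0.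
pose B := `|b| + 1.
have B0 : 0 < B by rewrite ltr_wpDl.
have := ab (- a / B).
have -> : - a / B * a + (- a / B) ^+ 2 * b = a ^+ 2 / B ^+ 2 * (b - B).
  by field; rewrite gt_eqF.
have K0 : 0 < a ^+ 2 / B ^+ 2.
  by apply: divr_gt0; [rewrite lt0r sqrf_eq0 a0 sqr_ge0 | rewrite exprn_gt0].
rewrite (pmulr_rge0 _ K0) subr_ge0 /B.
by move=> h; have := ler_norm b; lra.
Qed.

(** The weights are those for which a perturbation with
    [|X| <= |Y| / 4] costs at most [|Y| ^ 2 / 4], as in
    Cauchy-Schwarz. *)
Lemma cdot_le X Y : cdot X Y <= 2 * tnorm X ^+ 2 + 8^-1 * tnorm Y ^+ 2.
Proof.
rewrite !tnorm_sqr /cdot !mulr_sumr -big_split /=; apply: ler_sum => p _.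
have term (a b : R) : a * b <= 2 * a ^+ 2 + 8^-1 * b ^+ 2.
  by have := sqr_ge0 (4 * a - b); lra.
have := term (qre (X p)) (qre (Y p)); have := term (qi (X p)) (qi (Y p)).
have := term (qj (X p)) (qj (Y p)); have := term (qk (X p)) (qk (Y p)).
rewrite /qdot /normsq; lra.
Qed.

Lemma entry_sqr_le x c : entry x c ^+ 2 <=
  tnorm (zCq x) ^+ 2 + (\sum_l mdot (zA x l) (zA x l) + \sum_l mdot (zB x l) (zB x l)).
Proof.
have A0 : 0 <= \sum_l mdot (zA x l) (zA x l) by apply: sumr_ge0 => l _; exact: mdot_ge0.
have B0 : 0 <= \sum_l mdot (zB x l) (zB x l) by apply: sumr_ge0 => l _; exact: mdot_ge0.
case: c => [[[a p]|[l [a [i j]]]]|[l [a [i j]]]].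
- apply: (@le_trans _ _ (tnorm (zCq x) ^+ 2)); last by rewrite lerDl addr_ge0.
  rewrite tnorm_sqr (bigD1 p)//=; apply: ler_wpDr.
    by apply: sumr_ge0 => q _; exact: normsq_ge0.
  rewrite zCqE /normsq /=.
  have := sqr_ge0 (entry x (inl (inl (inord 0, p)))).
  have := sqr_ge0 (entry x (inl (inl (inord 1, p)))).
  have := sqr_ge0 (entry x (inl (inl (inord 2, p)))).
  by elim/ord3P: a; lra.
- apply: (@le_trans _ _ (\sum_l mdot (zA x l) (zA x l))); last first.
    by have := sqr_ge0 (tnorm (zCq x)); lra.
  rewrite (bigD1 l)//=; apply: ler_wpDr.
    by apply: sumr_ge0 => q _; exact: mdot_ge0.
  apply: le_trans (normsq_le_mdot _ i j); rewrite zAE /normsq /=.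
  set e := fun a : 'I_4 => entry x (inl (inr (Tagged (coordA n1 r) (a, (i, j))))).
  have e0 b : 0 <= e b ^+ 2 by exact: sqr_ge0.
  have := e0 (inord 0); have := e0 (inord 1); have := e0 (inord 2); have := e0 (inord 3).
  by rewrite /e; elim/ord4P: a; lra.
- apply: (@le_trans _ _ (\sum_l mdot (zB x l) (zB x l))); last first.
    by have := sqr_ge0 (tnorm (zCq x)); lra.
  rewrite (bigD1 l)//=; apply: ler_wpDr.
    by apply: sumr_ge0 => q _; exact: mdot_ge0.
  apply: le_trans (normsq_le_mdot _ i j); rewrite zBE /normsq /=.
  set e := fun a : 'I_4 => entry x (inr (Tagged (coordB n2 r) (a, (i, j)))).
  have e0 b : 0 <= e b ^+ 2 by exact: sqr_ge0.
  have := e0 (inord 0); have := e0 (inord 1); have := e0 (inord 2); have := e0 (inord 3).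
  by rewrite /e; elim/ord4P: a; lra.
Qed.

Lemma norm_sqr_le x : `|x| ^+ 2 <=
  tnorm (zCq x) ^+ 2 + (\sum_l mdot (zA x l) (zA x l) + \sum_l mdot (zB x l) (zB x l)).
Proof.
set S := _ + _.
have S0 : 0 <= S.
  apply: addr_ge0; first exact: sqr_ge0.
  by apply: addr_ge0; apply: sumr_ge0 => l _; exact: mdot_ge0.
rewrite -(sqr_sqrtr S0) ler_sqr ?nnegrE ?sqrtr_ge0//.
apply: norm_le_entry; first exact: sqrtr_ge0.
by move=> c; rewrite -sqrtr_sqr ler_wsqrtr// entry_sqr_le.
Qed.
Lemma zCqB x y p : zCq (x - y) p = zCq x p - zCq y p.
Proof.
rewrite zCqD -scaleN1r zCqZ ffunE; congr (_ + _); rewrite ffunE.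
by case: (zCq y p) => *; rewrite qrealZ; apply: quatP; rewrite /= mulN1r.
Qed.

Lemma feasible_entry x p : feasible M Omega x -> p \in Omega -> M p = zCq x p.
Proof.
move=> /(congr1 (fun X : tensor (quat R) n1 n2 n3 => X p)); rewrite [LHS]ffunE => + pO.
rewrite pO ffunE [X in _ + X]ffunE => /eqP.
by rewrite [X in _ == X]ffunE subr_eq0 => /eqP.
Qed.

Lemma perturbation_le (e td T T' : R) : e <= 2 * td + 8^-1 * T' ->
  td <= 4^-1 ^+ 2 * T -> T = T' -> - 4^-1 * T <= - e.
Proof. move=> h1 h2 h3; lra. Qed.

Lemma block_decrease (c b SA SB T T' g q1 q2 q3 fz fw1 fw2 fz' : R) :
  0 <= SA -> 0 <= SB -> c <= 4^-1 -> c <= b ->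
  fz = fw1 + g + q1 -> fw1 = fw2 + b * SA + q2 -> fw2 = fz' + b * SB + q3 ->
  - 4^-1 * T <= g -> T = T' -> 2^-1 * T' <= q1 -> 0 <= q2 -> 0 <= q3 -> 0 <= T ->
  c * (T + (SA + SB)) <= fz - fz'.
Proof.
move=> SA0 SB0 c4 cb -> -> -> gT TT' q1T q20 q30 T0; rewrite 2!mulrDr.
have := ler_wpM2r T0 c4; have := ler_wpM2r SA0 cb; have := ler_wpM2r SB0 cb; lra.
Qed.

Section OneStep.
Variables z z' : zvec.
Hypothesis z_feas : feasible M Omega z.
Hypothesis stepC : C_update mu M Omega lambda1 lambda2 z z'.
Hypothesis stepA : A_update mu lambda beta z z'.
Hypothesis stepB : B_update mu lambda beta z z'.

Let w1 := splice z' z z.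
Let w2 := splice z' z' z.

Lemma step_feasible : feasible M Omega z'.
Proof. by have [delta [_ _ _ [[_ Cf] _]]] := stepC. Qed.

(** First-order optimality in the C-step: moving along any C-direction that
    vanishes on [Omega] stays feasible, so the tilted objective has zero
    derivative in that direction. *)
Lemma C_stationary : exists delta,
  tnorm delta <= 4^-1 * tnorm (zCq (z' - z)) /\
  forall d, (forall p, p \in Omega -> zCq d p = 0) ->
    G w1 (splice d 0 0) = - cdot delta (zCq d).
Proof.
have [delta [_ dO dn [Cf Cmin]]] := stepC.
exists delta; split.
  have -> : zCq (z' - z) = zCq z' - zCq z.
    apply/ffunP => p; rewrite zCqD -scaleN1r zCqZ !ffunE /= qrealZ.
    by apply: quatP; rewrite /= ?mulN1r ?mulr0 ?oppr0.
  apply: le_trans dn; rewrite (_ : Defs.proj (~: Omega) delta = delta)//.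
  apply/ffunP => p; rewrite ffunE inE; case: ifPn => // /negPn pO.
  by have := congr1 (fun X : tensor (quat R) n1 n2 n3 => X p) dO; rewrite !ffunE pO.
move=> d dOmega.
apply/eqP; rewrite -subr_eq0 opprK; apply/eqP.
apply: (@linear_coef_eq0 _ (Q w1 (splice d 0 0))) => h.
have hmix : splice (z' + h *: d) z z = w1 + h *: splice d 0 0.
  by rewrite spliceZ /w1 spliceD !scaler0 !addr0.
have := Cmin (zCq (z' + h *: d)).
rewrite !C_objectiveE hmix -/w1 objective_expansion//; last first.
  move=> l; rewrite zAZ zBZ zA_splice zB_splice zA0 zB0 !scaler0.
  by rewrite mulmx0.
rewrite gradient_formZ// quadratic_formZ// zCqD cdotDr zCqZ cdotZr => H.
have : C_feasible M Omega (zCq z' + [ffun p => qreal h * zCq d p]).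
  have [_ zf] := Cf; split.
    apply/ffunP => p; rewrite !ffunE /=.
    by rewrite !mul0r !subr0 mulr0 addr0.
  have drop (X Y N : tensor (quat R) n1 n2 n3) p : Y p = 0 -> (X + Y - N) p = (X - N) p.
    by move=> Y0; rewrite !ffunE Y0 addr0.
  rewrite -zf; apply/ffunP => p; rewrite [LHS]ffunE [RHS]ffunE; case: ifP => // pO.
  by rewrite drop// ffunE (dOmega p pO) mulr0.
move=> /H; rewrite mulrDr; lra.
Qed.

(** The A-step minimizes the objective in [A] plus the proximal term
    [beta / (2 n3) * |A - zA z|^2]; the right-hand side is minus the derivative
    of the latter. *)
Lemma A_stationary d :
  G w2 (splice 0 d 0) = - (beta / n3%:R) * \sum_l mdot (zA (z' - z) l) (zA d l).
Proof.
have normal l : residual mu w2 l *m adjq (zB z l) + qreal lambda *: zA z' l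
    = qreal (- beta) *: zA (z' - z) l.
  have [_ Sinv] := gram_invqmx (zB z l) (addr_gt0 lambda_gt0 beta_gt0).
  have := congr1 (mulmx^~ (zB z l *m adjq (zB z l) + (qreal (lambda + beta))%:M)) (stepA l).
  rewrite -mulmxA Sinv mulmx1 mulmxDr mulmx_qreal mulmxA -/(zChat mu z' l) => e.
  rewrite zAB /residual zA_splice zB_splice zChat_splice mulmxBl.
  exact: ridge_residual e.
have dres l : dresidual mu w2 (splice 0 d 0) l = zA d l *m zB z l.
  by rewrite /dresidual zA_splice !zB_splice zA_splice zB0 mulmx0 add0r zChat_splice zChat0 subr0.
have term l : mdot (residual mu w2 l) (dresidual mu w2 (splice 0 d 0) l) =
    - beta * mdot (zA (z' - z) l) (zA d l) - lambda * mdot (zA z' l) (zA d l).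
  rewrite (dres l) mdotC mdot_mull mdotC -mdotZl -(normal l) mdotDl mdotZl.
  by rewrite addrK.
rewrite /gradient_form zCq_splice TVdot0r mulr0 addr0.
rewrite (eq_bigr _ (fun l _ => term l)) big_split /= -mulr_sumr sumrN -mulr_sumr.
have -> : \sum_l mdot (zB w2 l) (zB (splice 0 d 0) l) = 0.
  by apply: big1 => l _; rewrite !zB_splice zB0 mdot0r.
rewrite !zA_splice.
by move: (\sum_l mdot (zA (z' - z) l) _) (\sum_l mdot (zA z' l) _) => u v; field; rewrite gt_eqF.
Qed.

Lemma B_stationary d :
  G z' (splice 0 0 d) = - (beta / n3%:R) * \sum_l mdot (zB (z' - z) l) (zB d l).
Proof.
have normal l : adjq (zA z' l) *m residual mu z' l + qreal lambda *: zB z' l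
    = qreal (- beta) *: zB (z' - z) l.
  have := gram_invqmx (adjq (zA z' l)) (addr_gt0 lambda_gt0 beta_gt0).
  rewrite adjqK => -[Sinv _].
  have := congr1 (mulmx (adjq (zA z' l) *m zA z' l + (qreal (lambda + beta))%:M)) (stepB l).
  rewrite mulmxA Sinv mul1mx mulmxDl mul_scalar_mx -mulmxA -/(zChat mu z' l) => e.
  rewrite zBB /residual mulmxBr.
  exact: ridge_residual e.
have dres l : dresidual mu z' (splice 0 0 d) l = zA z' l *m zB d l.
  by rewrite /dresidual zA_splice !zB_splice zA0 mul0mx addr0 zChat_splice zChat0 subr0.
have term l : mdot (residual mu z' l) (dresidual mu z' (splice 0 0 d) l) =
    - beta * mdot (zB (z' - z) l) (zB d l) - lambda * mdot (zB z' l) (zB d l).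
  rewrite (dres l) mdotC mdot_mulr mdotC -mdotZl -(normal l) mdotDl mdotZl.
  by rewrite addrK.
rewrite /gradient_form zCq_splice TVdot0r mulr0 addr0.
rewrite (eq_bigr _ (fun l _ => term l)) big_split /= -mulr_sumr sumrN -mulr_sumr.
have -> : \sum_l mdot (zA z' l) (zA (splice 0 0 d) l) = 0.
  by apply: big1 => l _; rewrite zA_splice zA0 mdot0r.
rewrite !zB_splice.
by move: (\sum_l mdot (zB (z' - z) l) _) (\sum_l mdot (zB z' l) _) => u v; field; rewrite gt_eqF.
Qed.

(** Going backwards from [z'] to [z] block by block, the first-order terms are
    known by stationarity.  In A and B they contribute
    [beta / n3] times the squared step; in C the quadratic term gives 1/2 of
    the squared step, and the perturbation takes back at most 1/4. *)
Lemma step_descent : Num.min 4^-1 (beta / n3%:R) * `|z' - z| ^+ 2 <= f z - f z'.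
Proof.
have [delta [delta_le Cstat]] := C_stationary.
have zE : z = w1 + splice (z - z') 0 0.
  by rewrite /w1 spliceD addrC subrK !addr0 splice_id.
have w1E : w1 = w2 + splice 0 (z - z') 0.
  by rewrite /w1 /w2 spliceD !addr0 [z' + _]addrC subrK.
have w2E : w2 = z' + splice 0 0 (z - z').
  by rewrite -[X in X + splice _ _ _](splice_id z') /w2 spliceD !addr0 [z' + _]addrC subrK.
have AB0 x y w l : (x = 0 :> zvec \/ y = 0 :> zvec) ->
    zA (splice w x y) l *m zB (splice w x y) l = 0.
  by rewrite zA_splice zB_splice => -[->|->]; rewrite ?zA0 ?zB0 ?mul0mx ?mulmx0.
have expand x d : (forall l, zA d l *m zB d l = 0) -> f (x + d) = f x + G x d + Q x d.
  exact: objective_expansion.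
have f1 : f z = f w1 + G w1 (splice (z - z') 0 0) + Q w1 (splice (z - z') 0 0).
  apply: etrans (expand w1 (splice (z - z') 0 0) _); first exact: (congr1 f zE).
  by move=> l; apply: AB0; left.
have f2 : f w1 = f w2 + G w2 (splice 0 (z - z') 0) + Q w2 (splice 0 (z - z') 0).
  apply: etrans (expand w2 (splice 0 (z - z') 0) _); first exact: (congr1 f w1E).
  by move=> l; apply: AB0; right.
have f3 : f w2 = f z' + G z' (splice 0 0 (z - z')) + Q z' (splice 0 0 (z - z')).
  apply: etrans (expand z' (splice 0 0 (z - z')) _); first exact: (congr1 f w2E).
  by move=> l; apply: AB0; left.
have zzE l : zA (z - z') l = - zA (z' - z) l by rewrite -opprB -scaleN1r zAZ scalemx_qrealN1.
have zzE' l : zB (z - z') l = - zB (z' - z) l by rewrite -opprB -scaleN1r zBZ scalemx_qrealN1.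
set SA := \sum_l mdot (zA (z' - z) l) (zA (z' - z) l).
set SB := \sum_l mdot (zB (z' - z) l) (zB (z' - z) l).
have gA : G w2 (splice 0 (z - z') 0) = beta / n3%:R * SA.
  rewrite A_stationary mulNr -mulrN -sumrN; congr (_ * _).
  by apply: eq_bigr => l _; rewrite zzE mdotNr opprK.
have gB : G z' (splice 0 0 (z - z')) = beta / n3%:R * SB.
  rewrite B_stationary mulNr -mulrN -sumrN; congr (_ * _).
  by apply: eq_bigr => l _; rewrite zzE' mdotNr opprK.
have tE : tnorm (zCq (z' - z)) ^+ 2 = tnorm (zCq (z - z')) ^+ 2.
  rewrite !tnorm_sqr; apply: eq_bigr => p _.
  rewrite -(opprB z z') -scaleN1r zCqZ ffunE; case: (zCq _ p) => *.
  by rewrite qrealZ /normsq /=; ring.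
have gC : - 4^-1 * tnorm (zCq (z' - z)) ^+ 2 <= G w1 (splice (z - z') 0 0).
  rewrite Cstat => [|p pO]; last by rewrite zCqB -(feasible_entry z_feas pO) -(feasible_entry step_feasible pO) subrr.
  apply: perturbation_le (cdot_le delta (zCq (z - z'))) _ tE.
  by rewrite -exprMn ler_sqr ?nnegrE ?mulr_ge0 ?sqrtr_ge0.
have bn0 : 0 < beta / n3%:R by rewrite divr_gt0.
set c := Num.min _ _.
have c0 : 0 <= c by rewrite le_min invr_ge0 ler0n ltW.
have c4 : c <= 4^-1 by rewrite ge_min lexx.
have cb : c <= beta / n3%:R by rewrite ge_min lexx orbT.
have SA0 : 0 <= SA by apply: sumr_ge0 => l _; exact: mdot_ge0.
have SB0 : 0 <= SB by apply: sumr_ge0 => l _; exact: mdot_ge0.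
have T0 := sqr_ge0 (tnorm (zCq (z' - z))).
apply: (le_trans (ler_wpM2l c0 (norm_sqr_le (z' - z)))).
rewrite gA in f2; rewrite gB in f3.
by apply: (block_decrease SA0 SB0 c4 cb f1 f2 f3 gC tE);
  [exact: quadratic_form_C | exact: quadratic_form_ge0 | exact: quadratic_form_ge0 | ].
Qed.
End OneStep.

End Step.

(** * The relative error bound *)

Lemma loclip0_le (R : realType) (V : normedModType R) (h : V -> R) (B : R) :
  loclip h -> h 0 = 0 ->
  exists2 K, 0 <= K & forall x, `|x| <= B -> `|h x| <= K * `|x|.
Proof.
move=> lh h0; have [K K0 HK] := lh B; exists K => // x xB.
have := HK x 0 xB; rewrite h0 !subr0; apply.
by rewrite normr0 (le_trans _ xB).
Qed.

Section RelativeError.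
Variables (R : realType) (n1 n2 n3 : nat) (r : 'I_n3 -> nat).
Variables (mu : quat R) (M : tensor (quat R) n1 n2 n3).
Variable Omega : {set 'I_n1 * 'I_n2 * 'I_n3}.
Variables (lambda lambda1 lambda2 beta : R).
Hypothesis mu_unit_pure : unit_pure mu.
Hypothesis n3_gt0 : (0 < n3)%N.
Hypotheses (lambda_gt0 : 0 < lambda) (lambda1_gt0 : 0 < lambda1).
Hypotheses (lambda2_gt0 : 0 < lambda2) (beta_gt0 : 0 < beta).
Local Notation zvec := (zvec R n1 n2 r).
Local Notation f := (@objective R n1 n2 n3 r mu lambda lambda1 lambda2).
Local Notation G := (@gradient_form R n1 n2 n3 r mu lambda lambda1 lambda2).
Implicit Types (x y w d z : zvec) (X Y delta : tensor (quat R) n1 n2 n3).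

Let n3R : 0 < n3%:R :> R. Proof. by rewrite ltr0n. Qed.

Lemma normsq_le_tnorm X p : normsq (X p) <= tnorm X ^+ 2.
Proof.
rewrite tnorm_sqr (bigD1 p)//= lerDl; apply: sumr_ge0 => q _; exact: normsq_ge0.
Qed.

(** A crude bound: the sum of the absolute values of the components of [Y]
    serves as constant, since each component of [X] is at most its norm. *)
Lemma cdot_le_tnorm Y : exists2 L : R, 0 <= L & forall X, `|cdot X Y| <= L * tnorm X.
Proof.
exists (\sum_p (`|qre (Y p)| + `|qi (Y p)| + `|qj (Y p)| + `|qk (Y p)|)).
  by apply: sumr_ge0 => p _; rewrite !addr_ge0.
move=> X; rewrite mulr_suml; apply: le_trans (ler_norm_sum _ _ _) _.
apply: ler_sum => p _.
have comp (a b : R) : a ^+ 2 <= tnorm X ^+ 2 -> `|a * b| <= `|b| * tnorm X.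
  move=> aX; rewrite normrM mulrC ler_wpM2l//.
  by rewrite -(ler_sqr _ (sqrtr_ge0 _)) ?nnegrE// real_normK ?num_real.
have := normsq_le_tnorm X p; rewrite /normsq => Xp.
have h0 := sqr_ge0 (qre (X p)); have h1 := sqr_ge0 (qi (X p)).
have h2 := sqr_ge0 (qj (X p)); have h3 := sqr_ge0 (qk (X p)).
rewrite /qdot !mulrDl; do 3! (apply: le_trans (ler_normD _ _) _; apply: lerD;
  last by apply: comp; lra).
apply: comp; lra.
Qed.

Lemma tnorm_zCq_le x : tnorm (zCq x) <= Num.sqrt (\sum_(p : 'I_n1 * 'I_n2 * 'I_n3) 3) * `|x|.
Proof.
have S0 : 0 <= \sum_(p : 'I_n1 * 'I_n2 * 'I_n3) 3 :> R by apply: sumr_ge0.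
rewrite -ler_sqr ?nnegrE ?mulr_ge0 ?sqrtr_ge0// exprMn tnorm_sqr sqr_sqrtr// mulr_suml.
apply: ler_sum => p _; rewrite zCqE /normsq /=.
have e2 c : entry x c ^+ 2 <= `|x| ^+ 2.
  by rewrite -(real_normK (num_real (entry x c))) ler_sqr ?nnegrE// entry_le_norm.
have := e2 (inl (inl (inord 0, p))); have := e2 (inl (inl (inord 1, p))).
have := e2 (inl (inl (inord 2, p))); lra.
Qed.

Lemma norm2_le x : norm2 x <= Num.sqrt (\sum_(c < #|Defs.coord n1 n2 r|) 1) * `|x|.
Proof.
have S0 : 0 <= \sum_(c < #|Defs.coord n1 n2 r|) 1 :> R by apply: sumr_ge0.
have N0 : 0 <= \sum_c x 0 c ^+ 2 by apply: sumr_ge0 => c _; exact: sqr_ge0.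
rewrite -ler_sqr ?nnegrE ?mulr_ge0 ?sqrtr_ge0// exprMn !sqr_sqrtr// mulr_suml.
apply: ler_sum => c _; rewrite mul1r -(real_normK (num_real (x 0 c))) ler_sqr ?nnegrE//.
by have := entry_le_norm x (enum_val c); rewrite /entry enum_valK.
Qed.

Lemma entry_proj_grad (v : zvec) c : entry (proj_grad Omega v) c =
  match c with
  | inl (inl (_, p)) => if p \in Omega then 0 else entry v c
  | _ => entry v c
  end.
Proof.
rewrite /entry mxE enum_rankK; case: c => [[[a p]|//]|//].
by rewrite !ffunE inE; case: (p \in Omega).
Qed.

Definition unit_vec (c : Defs.coord n1 n2 r) : zvec := delta_mx 0 (enum_rank c).

Lemma entry_unit_vec c c' : entry (unit_vec c) c' = (c' == c)%:R.
Proof. by rewrite /entry mxE eqxx /= (inj_eq enum_rank_inj). Qed.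

Lemma entry_grad z c : (forall l, zA (unit_vec c) l *m zB (unit_vec c) l = 0) ->
  entry (grad f z) c = G z (unit_vec c).
Proof. by move=> AB0; rewrite /entry mxE derive_objective. Qed.

(** For a coordinate of the block C (outside [Omega]) or A, compare the
    derivative at [z'] with the one at the point reached when that block was
    updated, where stationarity bounds it by the length of the step; the two points
    differ by at most the step, and the derivative is locally Lipschitz.
    The block B is updated last, so [z'] itself is that point. *)
Lemma coordinate_error (B : R) c : exists2 K : R, 0 <= K & forall z z',
  C_update mu M Omega lambda1 lambda2 z z' ->
  A_update mu lambda beta z z' -> B_update mu lambda beta z z' ->
  `|z| <= B -> `|z'| <= B ->
  `|entry (proj_grad Omega (grad f z')) c| <= K * `|z' - z|.
Proof.
set v := unit_vec c.
have bn0 : 0 <= beta / n3%:R by rewrite divr_ge0// ltW.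
have [K1 K10 HK1] := loclip_gradient_form mu lambda lambda1 lambda2 n3_gt0 v B.
have mixB z z' :
    `|z' - splice z' z z| <= `|z' - z| /\ `|z' - splice z' z' z| <= `|z' - z|.
  have mixN x y w : z' - splice x y w = splice (z' - x) (z' - y) (z' - w).
    by rewrite -[X in X - _](splice_id z') -scaleN1r spliceZ spliceD !scaleN1r.
  by split; rewrite mixN; apply: norm_splice_le; rewrite // subrr normr0.

case: c @v HK1 => [[[a p]|la]|lb] v HK1.
- have vE : v = splice v 0 0.
    by apply: entry_inj => -[[c|c]|c]; rewrite entry_splice ?entry0// entry_unit_vec.
  have AB0 l : zA v l *m zB v l = 0 by rewrite vE zA_splice zA0 mul0mx.
  have [L L0 HL] := cdot_le_tnorm (zCq v).
  set T := Num.sqrt (\sum_(p : 'I_n1 * 'I_n2 * 'I_n3) 3 : R).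
  have T0 : 0 <= T by exact: sqrtr_ge0.
  exists (K1 + L * (4^-1 * T)); first by rewrite addr_ge0// !mulr_ge0.
  move=> z z' sC _ _ zB zB'; rewrite entry_proj_grad.
  case: ifPn => pO; first by rewrite normr0 mulr_ge0// addr_ge0// !mulr_ge0.
  rewrite entry_grad//.
  have [delta [delta_le Cstat]] := C_stationary lambda mu_unit_pure n3_gt0 sC.
  have w1E : G (splice z' z z) v = - cdot delta (zCq v).
    rewrite [in LHS]vE; apply: Cstat => q qO.
    have qp : q != p by apply: contraNneq pO => <-.
    have e b : entry v (inl (inl (b, q))) = 0.
      rewrite entry_unit_vec; case: eqP => // -[_ /eqP].
      by rewrite (negPf qp).
    by rewrite zCqE !e.
  have [d1 _] := mixB z z'.
  have := HK1 _ _ zB' (norm_splice_le zB' zB zB).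
  rewrite w1E opprK => h1.
  have h2 := HL delta.
  have h3 : tnorm delta <= 4^-1 * T * `|z' - z|.
    by apply: le_trans delta_le _; rewrite -mulrA ler_wpM2l// tnorm_zCq_le.
  have h4 := ler_normB (G z' v + cdot delta (zCq v)) (cdot delta (zCq v)).
  rewrite addrK in h4.
  rewrite mulrDl; apply: le_trans h4 _; apply: lerD.
    by apply: le_trans h1 _; rewrite ler_wpM2l.
  by apply: le_trans h2 _; rewrite -mulrA ler_wpM2l.
- have vE : v = splice 0 v 0.
    by apply: entry_inj => -[[c|c]|c]; rewrite entry_splice ?entry0// entry_unit_vec.
  have AB0 l : zA v l *m zB v l = 0 by rewrite vE zB_splice zB0 mulmx0.
  pose h x := \sum_l mdot (zA x l) (zA v l).
  have [K2 K20 HK2] : exists2 K, 0 <= K & forall x, `|x| <= B + B -> `|h x| <= K * `|x|.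
    apply: loclip0_le => [|]; last by apply: big1 => l _; rewrite zA0 mdot0l.
    apply: loclip_sum => l; apply: loclip_mdot; [exact: mloclip_zA | exact: mloclip_cst].
  exists (K1 + beta / n3%:R * K2).
    by rewrite addr_ge0// mulr_ge0// divr_ge0 ?ltW.
  move=> z z' _ sA _ zB zB'; rewrite entry_proj_grad entry_grad//.
  have w2E : G (splice z' z' z) v = - (beta / n3%:R) * h (z' - z).
    by rewrite [in LHS]vE; apply: A_stationary.
  have [_ d2] := mixB z z'.
  have h1 := HK1 _ _ zB' (norm_splice_le zB' zB' zB).
  have h2 : `|h (z' - z)| <= K2 * `|z' - z|.
    by apply: HK2; apply: le_trans (ler_normB _ _) _; exact: lerD.
  have := ler_normD (G z' v - G (splice z' z' z) v) (G (splice z' z' z) v).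
  rewrite subrK => h4; apply: le_trans h4 _; rewrite mulrDl; apply: lerD.
    by apply: le_trans h1 _; rewrite ler_wpM2l.
  by rewrite w2E normrM normrN (ger0_norm bn0) -(mulrA (beta / n3%:R)) ler_wpM2l.
- have vE : v = splice 0 0 v.
    by apply: entry_inj => -[[c|c]|c]; rewrite entry_splice ?entry0// entry_unit_vec.
  have AB0 l : zA v l *m zB v l = 0 by rewrite vE zA_splice zA0 mul0mx.
  pose h x := \sum_l mdot (zB x l) (zB v l).
  have [K2 K20 HK2] : exists2 K, 0 <= K & forall x, `|x| <= B + B -> `|h x| <= K * `|x|.
    apply: loclip0_le => [|]; last by apply: big1 => l _; rewrite zB0 mdot0l.
    apply: loclip_sum => l; apply: loclip_mdot; [exact: mloclip_zB | exact: mloclip_cst].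
  exists (beta / n3%:R * K2).
    by rewrite mulr_ge0// divr_ge0 ?ltW.
  move=> z z' _ _ sB zB zB'; rewrite entry_proj_grad entry_grad//.
  have w2E : G z' v = - (beta / n3%:R) * h (z' - z).
    by rewrite [in LHS]vE; apply: B_stationary.
  have h2 : `|h (z' - z)| <= K2 * `|z' - z|.
    by apply: HK2; apply: le_trans (ler_normB _ _) _; exact: lerD.
  by rewrite w2E normrM normrN (ger0_norm bn0) -(mulrA (beta / n3%:R)) ler_wpM2l.
Qed.

Lemma relative_error (B : R) : exists2 K : R, 0 <= K & forall z z',
  C_update mu M Omega lambda1 lambda2 z z' ->
  A_update mu lambda beta z z' -> B_update mu lambda beta z z' ->
  `|z| <= B -> `|z'| <= B ->
  norm2 (proj_grad Omega (grad f z')) <= K * `|z' - z|.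
Proof.
have /choice [K HK] : forall c, exists K : R, 0 <= K /\ forall z z',
  C_update mu M Omega lambda1 lambda2 z z' ->
  A_update mu lambda beta z z' -> B_update mu lambda beta z z' ->
  `|z| <= B -> `|z'| <= B ->
  `|entry (proj_grad Omega (grad f z')) c| <= K * `|z' - z|.
  by move=> c; have [K K0 HK] := coordinate_error B c; exists K.
set N := Num.sqrt (\sum_(c < #|Defs.coord n1 n2 r|) 1 : R).
have K0 : 0 <= \sum_c K c by apply: sumr_ge0 => c _; have [] := HK c.
exists (N * \sum_c K c); first by rewrite mulr_ge0 ?sqrtr_ge0.
move=> z z' sC sA sB zB zB'; apply: le_trans (norm2_le _) _.
rewrite -mulrA ler_wpM2l ?sqrtr_ge0//; apply: norm_le_entry; first by rewrite mulr_ge0.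
move=> c; apply: le_trans ((HK c).2 z z' sC sA sB zB zB') _.
rewrite ler_wpM2r// (bigD1 c)//= lerDl; apply: sumr_ge0 => c' _.
by have [] := HK c'.
Qed.

End RelativeError.

(** * Rates of convergence of the algorithm *)

Unset Implicit Arguments.

Theorem theorem4p5 (R : realType) (n1 n2 n3 : nat) (r : 'I_n3 -> nat)
    (mu : quat R) (M : tensor (quat R) n1 n2 n3)
    (Omega : {set 'I_n1 * 'I_n2 * 'I_n3})
    (lambda lambda1 lambda2 beta : R)
    (z : nat -> zvec R n1 n2 r) (zs : zvec R n1 n2 r) (theta : R)
    (n1_gt0 : (0 < n1)%N) (n2_gt0 : (0 < n2)%N) (n3_gt0 : (0 < n3)%N)
    (r_gt0 : forall l, (0 < r l)%N)
    (mu_unit_pure : unit_pure mu)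
    (M_pure : tmap (@qre R) M = 0)
    (lambda_gt0 : 0 < lambda) (lambda1_gt0 : 0 < lambda1)
    (lambda2_gt0 : 0 < lambda2) (beta_gt0 : 0 < beta)
    (z_QRTC : QRTC_sequence mu M Omega lambda lambda1 lambda2 beta z)
    (z_cvg : z @ \oo --> zs)
    (theta_ge0 : 0 <= theta) (theta_lt1 : theta < 1)
    (KL : KL_inequality mu M Omega lambda lambda1 lambda2 theta zs) :
  (0 < theta <= 2^-1 ->
     exists gamma xi : R, [/\ 0 < gamma, 0 < xi < 1 &
       forall t : nat, norm2 (z t - zs) <= gamma * xi ^+ t]) /\
  (2^-1 < theta < 1 ->
     exists2 gamma : R, 0 < gamma &
       forall t : nat, (1 <= t)%N ->
         norm2 (z t - zs)
           <= gamma * t%:R `^ (- ((1 - theta) / (2 * theta - 1)))).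
Proof.
have z_feas t : feasible M Omega (z t).
  case: t => [|t]; first by have [] := z_QRTC.
  by have [_ /(_ t) [/step_feasible]] := z_QRTC.
have stepC t : C_update mu M Omega lambda1 lambda2 (z t) (z t.+1).
  by have [_ /(_ t) []] := z_QRTC.
have stepA t : A_update mu lambda beta (z t) (z t.+1).
  by have [_ /(_ t) []] := z_QRTC.
have stepB t : B_update mu lambda beta (z t) (z t.+1).
  by have [_ /(_ t) []] := z_QRTC.
pose f := objective mu lambda lambda1 lambda2 : zvec R n1 n2 r -> R.
pose s t := f (z t) - f zs.
pose c := Num.min 4^-1 (beta / n3%:R).
have c_gt0 : 0 < c by rewrite lt_min invr_gt0 ltr0n divr_gt0 ?ltr0n.
have descent t : c * `|z t.+1 - z t| ^+ 2 <= s t - s t.+1.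
  rewrite /s opprB addrA subrK.
  exact: step_descent (z_feas t) (stepC t) (stepA t) (stepB t).
have s_cvg : s @ \oo --> 0.
  rewrite -(subrr (f zs)); apply: cvgB; last exact: cvg_cst.
  by apply: (loclip_cvg _ z_cvg); exact: loclip_objective.
have s_ge0 : forall t, 0 <= s t.
  apply: nonincreasing_cvg0_ge0 s_cvg => t; rewrite -subr_ge0.
  by apply: le_trans (descent t); rewrite mulr_ge0 ?exprn_ge0// ltW.
have [B zB] : exists B, forall t, `|z t| <= B.
  have [B0 [_ HB]] : bounded_fun z by apply: cvg_seq_bounded; apply/cvg_ex; exists zs.
  by exists (B0 + 1) => t; apply: HB => //; rewrite ltrDl.
have [K K0 HK] : exists2 K, 0 <= K & forall t,
    norm2 (proj_grad Omega (grad f (z t.+1))) <= K * `|z t.+1 - z t|.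
  have [K K0 HK] := @relative_error R n1 n2 n3 r mu M Omega lambda lambda1 lambda2 beta
    mu_unit_pure n3_gt0 lambda_gt0 beta_gt0 B.
  by exists K => // t; exact: HK (stepC t) (stepA t) (stepB t) (zB t) (zB t.+1).
have [Z' nZ' [K3 K30 KLZ]] := KL.
have [T _ HT] : \forall t \near \oo, Z' (z t) by exact: z_cvg.
have rel t : (T <= t)%N -> s t.+1 `^ theta <= (K3 * K + 1) * `|z t.+1 - z t|.
  move=> Tt; have := KLZ _ (HT t.+1 (leqW Tt)) (z_feas t.+1).
  rewrite -/f -/(s t.+1) (ger0_norm (s_ge0 _)) => /le_trans; apply.
  apply: (@le_trans _ _ (K3 * K * `|z t.+1 - z t|)).
    by rewrite -mulrA ler_wpM2l ?(ltW K30)//; apply: HK.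
  by rewrite ler_wpM2r// lerDl.
have K1_gt0 : 0 < K3 * K + 1 by rewrite ltr_wpDl// mulr_ge0// ltW.
set N := Num.sqrt (\sum_(c < #|Defs.coord n1 n2 r|) 1 : R).
have scale G u : 0 <= G -> 0 <= u -> forall t, `|z t - zs| <= G * u ->
    norm2 (z t - zs) <= (N * G + 1) * u.
  move=> G0 u0 t h; apply: le_trans (norm2_le _) _.
  rewrite mulrDl mul1r -mulrA ler_wpDr// ler_wpM2l ?sqrtr_ge0//.
(* the summand 1 makes the constant positive even when G is 0 *)
have gam G : 0 <= G -> 0 < N * G + 1.
  by move=> G0; rewrite ltr_wpDl// mulr_ge0// sqrtr_ge0.
split=> th.
  have [G [q [G0 q01 HG]]] := KL_linear_rate c_gt0 K1_gt0 z_cvg s_cvg descent rel th.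
  exists (N * G + 1), q; split; [exact: gam | exact: q01 | move=> t].
  by apply: scale => //; rewrite exprn_ge0// ltW//; case/andP: q01.
have [G G0 HG] := KL_sublinear_rate c_gt0 K1_gt0 z_cvg s_cvg descent rel th.
exists (N * G + 1); first exact: gam.
by move=> t t1; apply: scale; rewrite ?powR_ge0//; exact: HG.
Qed.
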